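(* For all nonnegative integers $k,l$ and every integer $n\ge 2k+l$, $$\gamma_{n-2k-l,k,l}=\frac{\binom{n-2k}{l}}{\binom{2(n-2k)}{2l}}\,\gamma_{n-2k,k,0},$$ where $\gamma_{n,k,l}=E\big[\{\Delta W_{1}(t,t+1)\}^{2n}\{A_{1,2}(t,t+1)\}^{2k}\{\Delta W_{2}(t,t+1)\}^{2l}\big]$ for nonnegative integers $n,k,l$.
   Context: Let $W_{1},W_{2}$ be independent standard (real-valued) Wiener processes and $t\ge 0$. Put $\Delta W_{i}(t,t+1)=W_{i}(t+1)-W_{i}(t)$, $i=1,2$, and define the stochastic area integral (Itô integrals) $$A_{1,2}(t,t+1)=\int_{t}^{t+1}\int_{t}^{s}dW_{1}(r)\,dW_{2}(s)-\int_{t}^{t+1}\int_{t}^{s}dW_{2}(r)\,dW_{1}(s).$$ *)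

(* Defs.v *)
From HB Require Import structures.
From mathcomp Require Import all_boot all_order all_algebra.
From mathcomp Require Import all_classical all_reals all_analysis.
Import Order.TTheory GRing.Theory Num.Theory.
Import numFieldNormedType.Exports.
Set Implicit Arguments.
Unset Strict Implicit.
Unset Printing Implicit Defensive.

Local Open Scope classical_set_scope.
Local Open Scope ring_scope.

Section Processes.
Context (d : measure_display) (T : measurableType d) (R : realType).
Variable P : probability T R.

(* A process is a family of random variables indexed by R; only its values at
   nonnegative times are ever constrained or used. *)

Definition rv_events (X : T -> R) : set (set T) :=
  preimage_set_system setT X measurable.

(* sigma (W r : r in D) *)
Definition process_events (D : set R) (W : R -> {RV P >-> R}) : set (set T) :=
  <<s \bigcup_(r in D) rv_events (W r) >>.

(* The law of increments is compared with the normal distribution on measurable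
   sets only, and only for s < t: the value of a measure on a non-measurable set
   is arbitrary, and [normal_prob m 0] is not the Dirac mass at m. The second
   argument of [normal_prob] is the standard deviation. *)
Record standard_wiener (W : R -> {RV P >-> R}) : Prop := {
  wiener_start : {ae P, forall w, W 0 w = 0} ;
  wiener_indep_increments : forall (n : nat) (u : nat -> R),
    0 <= u 0%N -> (forall i, (i < n)%N -> u i <= u i.+1) ->
    forall B : nat -> set R, (forall i, measurable (B i)) ->
    P (\bigcap_(i in [set i | (i < n)%N])
         [set w | B i (W (u i.+1) w - W (u i) w)]) =
    (\prod_(i < n) P [set w | B i (W (u i.+1) w - W (u i) w)%R])%E ;
  wiener_normal_increments : forall s t : R, 0 <= s -> s < t ->
    forall B : set R, measurable B ->
    P [set w | B (W t w - W s w)] = normal_prob 0 (Num.sqrt (t - s)) B ;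
  wiener_continuous :
    {ae P, forall w, {within `[0, +oo[, continuous (fun t => W t w)}} }.

Definition independent_processes (W1 W2 : R -> {RV P >-> R}) : Prop :=
  forall A B : set T,
    process_events `[0, +oo[ W1 A -> process_events `[0, +oo[ W2 B ->
    P (A `&` B) = (P A * P B)%E.

Definition joint_filtration (W1 W2 : R -> {RV P >-> R}) (s : R) : set (set T) :=
  <<s process_events `[0, s] W1 `|` process_events `[0, s] W2 >>.

(* sum_(i < n) xi_i 1_]u_i, u_(i+1)] with a = u_0 <= ... <= u_n = b and xi_i
   square-integrable and F_(u_i)-measurable *)
Record simple_process (F : R -> set (set T)) (a b : R) := SimpleProcess {
  sp_size : nat ;
  sp_time : nat -> R ;
  sp_coef : nat -> {RV P >-> R} ;
  sp_time_first : sp_time 0%N = a ;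
  sp_time_last : sp_time sp_size = b ;
  sp_time_le : forall i, (i < sp_size)%N -> sp_time i <= sp_time i.+1 ;
  sp_coef_adapted : forall i, (i < sp_size)%N ->
    rv_events (sp_coef i) `<=` F (sp_time i) ;
  sp_coef_L2 : forall i, (i < sp_size)%N ->
    ('E_P[fun w => (sp_coef i w ^+ 2)%R] < +oo)%E }.

Definition sp_val F a b (S : simple_process F a b) (s : R) (w : T) : R :=
  \sum_(i < sp_size S)
    sp_coef S i w * \1_(`]sp_time S i, sp_time S i.+1]) s.

Definition sp_integral F a b (S : simple_process F a b)
    (W : R -> {RV P >-> R}) (w : T) : R :=
  \sum_(i < sp_size S)
    sp_coef S i w * (W (sp_time S i.+1) w - W (sp_time S i) w).

(* I is (a version of) the Ito integral of H with respect to W over [a, b]: an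
   L^2(P)-limit of integrals of simple F-adapted processes that converge to H in
   L^2([a, b] x T). Such a limit exists only if H is square-integrable and
   adapted up to null sets. *)
Definition is_ito_integral (F : R -> set (set T)) (W : R -> {RV P >-> R})
    (a b : R) (H : R -> T -> R) (I : {RV P >-> R}) : Prop :=
  measurable_fun (`[a, b] `*` [set: T]) (fun x : R * T => H x.1 x.2) /\
  exists S : nat -> simple_process F a b,
    ((fun m => \int[P]_w \int[lebesgue_measure]_(s in `[a, b])
        ((H s w - sp_val (S m) s w) ^+ 2)%R%:E) @ \oo --> 0)%E /\
    ((fun m => 'E_P[fun w => ((I w - sp_integral (S m) W w) ^+ 2)%R])
        @ \oo --> 0)%E.

(* I is the iterated Ito integral
   int_a^b int_a^s dV(r) dW(s), the inner integral being a measurable process J *)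
Definition is_iterated_ito_integral (F : R -> set (set T))
    (V W : R -> {RV P >-> R}) (a b : R) (I : {RV P >-> R}) : Prop :=
  exists J : R -> {RV P >-> R},
    (forall s, s \in `[a, b] ->
       is_ito_integral F V a s (fun _ _ => 1) (J s)) /\
    is_ito_integral F W a b (fun s w => J s w) I.

Definition is_area_integral (W1 W2 : R -> {RV P >-> R}) (a b : R)
    (A : {RV P >-> R}) : Prop :=
  let F := joint_filtration W1 W2 in
  exists I12 I21 : {RV P >-> R},
    [/\ is_iterated_ito_integral F W1 W2 a b I12,
        is_iterated_ito_integral F W2 W1 a b I21 &
        {ae P, forall w, A w = I12 w - I21 w}].

Definition gamma (W1 W2 : R -> {RV P >-> R}) (t : R) (A : {RV P >-> R})
    (n k l : nat) : \bar R :=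
  'E_P[fun w => (W1 (t + 1) w - W1 t w) ^+ (2 * n) * A w ^+ (2 * k) *
                (W2 (t + 1) w - W2 t w) ^+ (2 * l)].

End Processes.

(* Main.v *)
Require Import Defs.
From HB Require Import structures.
From mathcomp Require Import all_boot all_order all_algebra.
From mathcomp Require Import all_classical all_reals all_analysis.
From mathcomp Require Import measurable_realfun ring lra.
Import Order.TTheory GRing.Theory Num.Theory.
Import numFieldNormedType.Exports.
Set Implicit Arguments.
Unset Strict Implicit.
Unset Printing Implicit Defensive.

(** Write X, Y for the two increments and A for the area. The law of (X, Y, A) is
    invariant under the rotations (X, Y) |-> (c X + s Y, - s X + c Y) fixing A.
    Hence E[(c X + s Y)^(2m) f(A)] = E[X^(2m) f(A)] for bounded f, and since
    1 = (c^2 + s^2)^m, comparing the coefficients of c^(2m - 2l) s^(2l) gives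
    C(2m, 2l) E[X^(2m - 2l) Y^(2l) f(A)] = C(m, l) E[X^(2m) f(A)]. Taking for f
    the truncations of a |-> a^(2k), monotone convergence concludes; in
    particular the moments need not be known to be finite.

    By the Ito isometry, A is the L^2 limit of the sums
    sum_i (X_i dW2_i - Y_i dW1_i) over regular subdivisions, so it suffices to
    prove the invariance for these. The triple (X_i, Y_i, partial sum) is a Markov
    chain whose transition commutes with rotations and is driven by independent
    Gaussian pairs, and a Gaussian pair is rotation invariant because a rotation
    is a product of shears, which preserve Lebesgue measure by Fubini. *)

Local Open Scope classical_set_scope.
Local Open Scope ring_scope.

(** * Rotation invariance of Gaussian pairs *)

(** Rotations fix the area because its infinitesimal increment x dW2 - y dW1 is the determinant of
    position and increment. As this increment involves the current position, invariance cannot be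
    propagated for the area alone, whence the chain of triples.

    Two obstacles shape the rest. The definition of the Ito integral provides some approximating
    simple processes on unknown subdivisions, which must be compared with the Riemann sums; the
    isometry is therefore proved for sums over intervals that may overlap, so that it covers the
    difference of two step processes. Moreover, L^2 convergence of the area sums does not carry
    E[X^(2m) A^(2k)] to the limit. The truncation of a^(2k) is therefore both bounded and Lipschitz,
    and the unbounded weight p = X^(2m) is separated from the error D by p L |D| <= eps p^2 + (L^2 /
    eps) D^2, where p has a finite second moment.

    Wherever possible the integrands are nonnegative, so that Tonelli applies and infinite values do
    no harm. *)

Section density.
Local Open Scope ereal_scope.
Context d (T : measurableType d) (R : realType).
Variables (mu nu : {measure set T -> \bar R}) (g : T -> R).
Hypotheses (mg : measurable_fun setT g) (g0 : forall x, (0 <= g x)%R).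
Hypothesis nuE : forall A, measurable A -> nu A = \int[mu]_(x in A) (g x)%:E.

Import HBNNSimple.

(** Both sides are monotone limits along the simple functions increasing to [f], and on indicators
    the claim is [nuE]. *)
Lemma ge0_integral_density (f : T -> \bar R) : measurable_fun setT f ->
  (forall x, 0 <= f x) -> \int[nu]_x f x = \int[mu]_x (f x * (g x)%:E).
Proof.
move=> mf f0; pose h := nnsfun_approx measurableT mf.
have mg' : measurable_fun setT (EFin \o g) by exact/measurable_EFinP.
have h_cvg x : (EFin \o h n) x @[n --> \oo] --> f x.
  by apply: cvg_nnsfun_approx.
have -> : \int[nu]_x f x = limn (fun n => \int[nu]_x (EFin \o h n) x).
  rewrite -monotone_convergence//=; last 3 first.
  - by move=> n; exact/measurable_EFinP.
  - by move=> n x _; rewrite lee_fin.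
  - by move=> x _ a b ab; rewrite lee_fin; exact/lefP/nd_nnsfun_approx.
  by apply: eq_integral => x _; apply/esym/cvg_lim => //; exact: h_cvg.
have -> : \int[mu]_x (f x * (g x)%:E) =
    limn (fun n => \int[mu]_x ((EFin \o h n) x * (g x)%:E)).
  rewrite -monotone_convergence//=; last 3 first.
  - by move=> n; apply: emeasurable_funM => //; exact/measurable_EFinP.
  - by move=> n x _; rewrite mule_ge0 ?lee_fin.
  - move=> x _ a b ab; rewrite lee_wpmul2r ?lee_fin//.
    exact/lefP/nd_nnsfun_approx.
  apply: eq_integral => x _; apply/esym/cvg_lim => //.
  by apply: cvgeZr => //; exact: h_cvg.
congr (limn _); apply/funext => n.
transitivity (\int[nu]_x
   (\sum_(y \in range (h n)) (y * \1_(h n @^-1` [set y]) x)%:E)).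
  by apply: eq_integral => x _; rewrite /= fimfunE -fsumEFin.
rewrite ge0_integral_fsum//; last 2 first.
- by move=> y; apply/measurable_EFinP; exact: measurable_funM.
- by move=> y x _; exact: nnfun_muleindic_ge0.
transitivity (\int[mu]_x (\sum_(y \in range (h n))
    (y * \1_(h n @^-1` [set y]) x)%:E * (g x)%:E)); last first.
  apply: eq_integral => x _; rewrite [in RHS]/= fimfunE -fsumEFin//.
  by rewrite ge0_mule_fsuml// => y; exact: nnfun_muleindic_ge0.
rewrite ge0_integral_fsum//; last 2 first.
- move=> y; apply: emeasurable_funM => //.
  by apply/measurable_EFinP; exact: measurable_funM.
- by move=> y x _; apply: mule_ge0; rewrite ?lee_fin//; exact: nnfun_muleindic_ge0.
apply: eq_fsbigr => r /[!inE]-[x _ hxr].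
have r0 : (0 <= r)%R by rewrite -hxr.
have mr : measurable (h n @^-1` [set r]) by exact: measurable_sfunP.
under eq_integral do rewrite EFinM.
under [RHS]eq_integral do rewrite EFinM -muleA.
rewrite ge0_integralZl//; last exact/measurable_EFinP/measurable_indic.
rewrite ge0_integralZl//; last 2 first.
- by apply: emeasurable_funM => //; exact/measurable_EFinP/measurable_indic.
- by move=> y _; rewrite mule_ge0 ?lee_fin.
congr *%E; rewrite integral_indic// setIT nuE// integral_mkcond.
apply: eq_integral => y _; rewrite patchE indicE.
by case: ifPn => _; rewrite ?mul1e ?mul0e.
Qed.

End density.

Section lebesgue_translation.
Context {R : realType}.
Notation mu := (@lebesgue_measure R).

(** Lebesgue measure is determined by its values on the intervals ]x, y], and the pushforward by the
    translation gives ]x, y] the length of ]x - a, y - a]. *)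
Lemma lebesgue_measure_shift (a : R) (A : set (measurableTypeR R)) :
  measurable A -> mu ((fun x => x + a) @^-1` A) = mu A.
Proof.
pose s := fun x : measurableTypeR R => (x + a : measurableTypeR R).
have ms : measurable_fun setT s by apply: measurable_funD.
pose s' := HB.pack_for {mfun measurableTypeR R >-> measurableTypeR R} s
  (isMeasurableFun.Build _ _ _ _ s ms).
move=> mA; apply/esym.
apply: (@lebesgue_measure_unique _ (pushforward mu s')) => // X.
move=> [[x y] _ <-]; transitivity (mu `]x - a, y - a]%classic); last first.
  congr (mu _); apply/seteqP.
  by split => z /=; rewrite /s !in_itv/= ltrBlDr lerBrDr.
rewrite !lebesgue_measure_itv/= !lte_fin.
rewrite ltrD2r; case: ifP => // _.
by rewrite -!EFinB; congr EFin; ring.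
Qed.

Lemma ge0_integral_shift (a : R) (f : R -> \bar R) :
  measurable_fun setT f -> (forall x, (0 <= f x)%E) ->
  (\int[mu]_x f (x + a)%R = \int[mu]_x f x)%E.
Proof.
move=> mf f0.
pose s := fun x : measurableTypeR R => (x + a : measurableTypeR R).
have ms : measurable_fun setT s by apply: measurable_funD.
pose s' := HB.pack_for {mfun measurableTypeR R >-> measurableTypeR R} s
  (isMeasurableFun.Build _ _ _ _ s ms).
rewrite [RHS](eq_measure_integral (pushforward mu s')); last first.
  by move=> A mA _; rewrite /= /pushforward lebesgue_measure_shift.
by rewrite ge0_integral_pushforward.
Qed.

End lebesgue_translation.

Section lebesgue_rotation.
Local Open Scope ereal_scope.
Context {R : realType}.
Notation mu := (@lebesgue_measure R).

(** After Tonelli the inner variable is x, and for fixed y the shear is a translation by k y. *)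
Let shear_fst (k : R) (f : R * R -> \bar R) :
  measurable_fun setT f -> (forall p, 0 <= f p) ->
  \int[mu]_x \int[mu]_y f ((x + k * y)%R, y) = \int[mu]_x \int[mu]_y f (x, y).
Proof.
move=> mf f0.
pose F (p : R * R) := f ((p.1 + k * p.2)%R, p.2).
transitivity (\int[mu]_y \int[mu]_x F (x, y)).
  have mF : measurable_fun setT F.
    apply: (measurableT_comp mf); apply: measurable_fun_pair => //=.
    by apply: measurable_funD => //; exact: measurable_funM.
  by have := @fubini_tonelli _ _ _ _ R mu mu F mF (fun=> f0 _); exact.
rewrite (@fubini_tonelli _ _ _ _ R mu mu f)//; apply: eq_integral => y _.
rewrite (@ge0_integral_shift R (k * y)%R (fun x : R => f (x, y : R)))//.
exact: measurableT_comp.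
Qed.

Let shear_snd (k : R) (f : R * R -> \bar R) :
  measurable_fun setT f -> (forall p, 0 <= f p) ->
  \int[mu]_x \int[mu]_y f (x, (y + k * x)%R) = \int[mu]_x \int[mu]_y f (x, y).
Proof.
move=> mf f0; apply: eq_integral => x _.
rewrite (@ge0_integral_shift R (k * x)%R (fun y : R => f (x : R, y)))//.
exact: measurableT_comp.
Qed.

Definition rotation (c s : R) (p : R * R) : R * R :=
  (c * p.1 + s * p.2, - s * p.1 + c * p.2)%R.

Lemma measurable_rotation c s : measurable_fun setT (rotation c s).
Proof.
by apply: measurable_fun_pair => /=;
  apply: measurable_funD; exact: measurable_funM.
Qed.

(* A rotation by an angle other than pi is a product of three shears. *)
Lemma ge0_integral_rotation (c s : R) (f : R * R -> \bar R) :
  (c ^+ 2 + s ^+ 2 = 1)%R -> (0 < 1 + c)%R ->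
  measurable_fun setT f -> (forall p, 0 <= f p) ->
  \int[mu]_x \int[mu]_y f (rotation c s (x, y)) =
  \int[mu]_x \int[mu]_y f (x, y).
Proof.
(* For c = cos u and s = sin u, k is tan (u / 2): the rotation is the product of the shears with
   parameters k, - s, k. *)
move=> cs1 c1 mf f0; pose k : R := (s / (1 + c))%R.
have kc : (k * (1 + c) = s)%R by rewrite /k divfK// gt_eqF.
have ks : (k * s = 1 - c)%R.
  apply: (mulfI (lt0r_neq0 c1)); rewrite mulrA (mulrC _ k) kc; nra.
pose f1 (p : R * R) := f ((p.1 + k * p.2)%R, p.2).
pose f2 (p : R * R) := f1 (p.1, (p.2 + (- s) * p.1)%R).
have mf1 : measurable_fun setT f1.
  apply: (measurableT_comp mf); apply: measurable_fun_pair => //=.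
  by apply: measurable_funD => //; exact: measurable_funM.
have mf2 : measurable_fun setT f2.
  apply: (measurableT_comp mf1); apply: measurable_fun_pair => //=.
  by apply: measurable_funD => //; exact: measurable_funM.
have f10 p : 0 <= f1 p by exact: f0.
have f20 p : 0 <= f2 p by exact: f0.
transitivity (\int[mu]_x \int[mu]_y f2 ((x + k * y)%R, y)); last first.
  rewrite (shear_fst _ mf2 f20); transitivity (\int[mu]_x \int[mu]_y f1 (x, y)).
    by rewrite -[RHS](shear_snd (- s)).
  by rewrite -[RHS](shear_fst k).
apply: eq_integral => x _; apply: eq_integral => y _.
have e1 (a b : R) : (a + k * b + k * (b + - s * (a + k * b)) = c * a + s * b)%R.
  transitivity ((1 - k * s) * a + k * (1 + (1 - k * s)) * b)%R; first by ring.
  by rewrite ks subKr kc.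
have e2 (a b : R) : (b + - s * (a + k * b) = - s * a + c * b)%R.
  transitivity (- s * a + (1 - k * s) * b)%R; first by ring.
  by rewrite ks subKr.
by rewrite /f2 /f1 /rotation /= e1 e2.
Qed.

End lebesgue_rotation.

Section gaussian.
Local Open Scope ereal_scope.
Context {R : realType} (sigma : R).
Hypothesis sigma0 : sigma != 0%R.
Notation mu := (@lebesgue_measure R).
Notation N := (@normal_prob R 0 sigma).
Notation g := (normal_pdf 0 sigma).

Lemma ge0_integral_normal_prob (f : R -> \bar R) :
  measurable_fun setT f -> (forall x, 0 <= f x) ->
  \int[N]_x f x = \int[mu]_x (f x * (g x)%:E).
Proof.
move=> mf f0; apply: ge0_integral_density => //.
- exact: measurable_normal_pdf.
- by move=> x; exact: normal_pdf_ge0.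
Qed.

(** The product density depends on x^2 + y^2 only, so it can be absorbed into the integrand before
    Lebesgue measure is rotated. *)
Lemma ge0_integral_normal_prob_rotation (c s : R) (f : R * R -> \bar R) :
  (c ^+ 2 + s ^+ 2 = 1)%R -> (0 < 1 + c)%R ->
  measurable_fun setT f -> (forall p, 0 <= f p) ->
  \int[N]_x \int[N]_y f (rotation c s (x, y)) = \int[N]_x \int[N]_y f (x, y).
Proof.
move=> cs1 c1.
pose gg (p : R * R) : \bar R := (g p.1 * g p.2)%:E.
have mgg : measurable_fun setT gg.
  apply/measurable_EFinP; apply: measurable_funM;
  by apply: measurableT_comp => //; exact: measurable_normal_pdf.
have gg0 p : 0 <= gg p by rewrite lee_fin mulr_ge0// normal_pdf_ge0.
have E (h : R * R -> \bar R) : measurable_fun setT h -> (forall p, 0 <= h p) ->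
    \int[N]_x \int[N]_y h (x, y) =
    \int[mu]_x \int[mu]_y (h (x, y) * gg (x, y)).
  move=> mf f0; rewrite ge0_integral_normal_prob//; last 2 first.
  - exact: measurable_fun_fubini_tonelli_F.
  - by move=> x; exact: integral_ge0.
  apply: eq_integral => x _.
  have mfx : measurable_fun setT (fun y => h (x, y)) by exact: measurableT_comp.
  rewrite ge0_integral_normal_prob// -ge0_integralZr//; last 3 first.
  - apply: emeasurable_funM => //.
    by apply/measurable_EFinP; exact: measurable_normal_pdf.
  - by move=> y _; rewrite mule_ge0// lee_fin normal_pdf_ge0.
  - by rewrite lee_fin normal_pdf_ge0.
  by apply: eq_integral => y _; rewrite -muleA -EFinM mulrC.
move=> mf f0; rewrite (E f)//.
have mfr : measurable_fun setT (f \o rotation c s).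
  by apply: (measurableT_comp mf); exact: measurable_rotation.
rewrite [LHS](E (f \o rotation c s) mfr (fun=> f0 _)).
pose fg p := f p * gg p.
have mfg : measurable_fun setT fg by exact: emeasurable_funM.
have fg0 p : 0 <= fg p by rewrite mule_ge0.
transitivity (\int[mu]_x \int[mu]_y fg (rotation c s (x, y))); last first.
  exact: ge0_integral_rotation.
apply: eq_integral => x _; apply: eq_integral => y _; congr *%E.
rewrite /gg !normal_pdfE//= mulrACA [in RHS]mulrACA /normal_fun -!expRD.
congr ((_ * expR _)%:E); rewrite !mulNr -!opprD -!mulrDl; congr (- (_ / _))%R.
by rewrite !subr0; nra.
Qed.

(** With y = x^2 / (4 sigma^2), the bound y^n <= n! e^y trades the power for half of the exponent in
    e^(- 2 y). What remains is [K] times the density of deviation sqrt 2 sigma, which has integral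
    1. *)
Lemma normal_prob_moment_lty (n : nat) : \int[N]_x (x ^+ (2 * n))%:E < +oo.
Proof.
pose K : R := ((sigma ^+ 2 *+ 4) ^+ n * n`!%:R *
  (normal_peak sigma / normal_peak (Num.sqrt 2 * sigma)))%R.
have s0 : (0 < sigma ^+ 2)%R by rewrite exprn_even_gt0.
have rs0 : (Num.sqrt 2 * sigma != 0 :> R)%R by rewrite mulf_neq0// sqrtr_eq0 -ltNge.
have pk0 := normal_peak_gt0 rs0; have pk1 := normal_peak_gt0 sigma0.
have K0 : (0 <= K)%R.
  apply: mulr_ge0; last by rewrite divr_ge0// ltW.
  by rewrite mulr_ge0// exprn_ge0// mulrn_wge0// ltW.
have mp s : measurable_fun [set: R] (fun x => (normal_pdf 0 s x)%:E).
  by apply/measurable_EFinP; exact: measurable_normal_pdf.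
rewrite ge0_integral_normal_prob//; last 2 first.
- exact/measurable_EFinP/measurable_funX.
- by move=> x; rewrite lee_fin exprM exprn_ge0// sqr_ge0.
apply: (@le_lt_trans _ _
    (\int[mu]_x (K%:E * (normal_pdf 0 (Num.sqrt 2 * sigma) x)%:E))); last first.
  rewrite ge0_integralZl//=.
  - by rewrite integral_normal_pdf mule1 ltry.
  - exact: mp.
  - by move=> x _; rewrite lee_fin normal_pdf_ge0.
apply: ge0_le_integral => //=.
- move=> x _; rewrite mule_ge0 ?lee_fin ?normal_pdf_ge0//.
  by rewrite exprM exprn_ge0// sqr_ge0.
- have mX : measurable_fun [set: R] (fun x : R => (x ^+ (2 * n))%:E).
    exact/measurable_EFinP/measurable_funX.
  exact: emeasurable_funM mX (mp _).
- have mK : measurable_fun [set: R] (cst K%:E) by exact: measurable_cst.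
  exact: emeasurable_funM mK (mp _).
move=> x _; rewrite -!EFinM lee_fin !normal_pdfE//= /normal_fun !subr0.
pose y : R := (x ^+ 2 / (sigma ^+ 2 *+ 4))%R.
have y0 : (0 <= y)%R by rewrite divr_ge0 ?sqr_ge0// ltW// pmulrn_lgt0.
have yx : (x ^+ 2 = (sigma ^+ 2 *+ 4) * y)%R.
  by rewrite mulrC divfK// gt_eqF// pmulrn_lgt0.
have -> : (- x ^+ 2 / (sigma ^+ 2 *+ 2) = - (y + y))%R.
  by rewrite yx; field.
have -> : (- x ^+ 2 / ((Num.sqrt 2 * sigma) ^+ 2 *+ 2) = - y)%R.
  by rewrite yx exprMn sqr_sqrtr//; field.
have yn m : (y ^+ m <= m`!%:R * expR y)%R.
  case: m => [|m]; first by rewrite expr0 fact0 mul1r -expR0 ler_expR.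
  have := expR_ge1Dxn m y0; rewrite -ler_pdivrMl ?ltr0n ?fact_gt0// mulrC.
  by apply: le_trans; rewrite lerDr.
rewrite exprM yx exprMn /K opprD expRD expRN.
set e := expR y; have e0 : (0 < e)%R by exact: expR_gt0.
rewrite [X in (_ <= X)%R](_ : _ = (sigma ^+ 2 *+ 4) ^+ n * (n`!%:R * e) *
  (normal_peak sigma * (e^-1 * e^-1)))%R; last by field; rewrite !gt_eqF.
apply: ler_wpM2r.
  by apply: mulr_ge0; [exact: ltW|rewrite mulr_ge0// invr_ge0 ltW].
by rewrite ler_wpM2l// exprn_ge0// ltW// pmulrn_lgt0.
Qed.

End gaussian.

Section gaussian_variance.
Local Open Scope ereal_scope.
Context {R : realType}.
Notation mu := (@lebesgue_measure R).

(* This is 1, but only the proportionality of the variance to sigma ^+ 2 is needed. *)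
Definition std_variance : R := fine (\int[@normal_prob R 0 1]_x (x ^+ 2)%:E).

Lemma integral_normal_prob_sqr (sigma : R) : (0 < sigma)%R ->
  \int[@normal_prob R 0 sigma]_x (x ^+ 2)%:E = (std_variance * sigma ^+ 2)%:E.
Proof.
move=> s0; have sn0 := lt0r_neq0 s0.
have m2 : measurable_fun [set: R] (fun x : R => (x ^+ 2)%:E).
  exact/measurable_EFinP/measurable_funX.
have x20 (x : R) : 0 <= (x ^+ 2)%:E by rewrite lee_fin sqr_ge0.
have v1 : \int[@normal_prob R 0 1]_x (x ^+ 2)%:E = std_variance%:E.
  rewrite fineK// ge0_fin_numE ?integral_ge0//.
  exact: (@normal_prob_moment_lty _ 1 (oner_neq0 _) 1).
rewrite ge0_integral_normal_prob//.
(* Scaling by [sigma] turns the standard Gaussian density into that of deviation [sigma]. *)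
pose F (x : R^o) : R^o := (sigma * x)%R.
have F' : F^`()%classic = cst sigma.
  apply/funext => x; rewrite derive1E deriveM// derive_id derive_cst.
  by rewrite scaler0 addr0 /GRing.scale/= mulr1.
transitivity (\int[mu]_x (x ^+ 2 * normal_pdf 0 sigma x)%:E) => //.
rewrite (@increasing_ge0_integration_by_substitutionT _ F)//; last 8 first.
- by move=> x y xy; rewrite /F ltr_pM2l.
- by rewrite F' => x; exact: cvg_cst.
- by rewrite F'; exact: is_cvg_cst.
- by rewrite F'; exact: is_cvg_cst.
- by apply/gt0_cvgMrNy; last exact: cvg_id.
- by apply/gt0_cvgMry; last exact: cvg_id.
- move=> x; apply: cvgM; first exact: exprn_continuous.
  exact: continuous_normal_pdf.
- by move=> x; rewrite mulr_ge0 ?sqr_ge0// normal_pdf_ge0.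
rewrite [in RHS]mulrC EFinM -v1 ge0_integral_normal_prob ?oner_neq0//.
rewrite -ge0_integralZl//; last 2 first.
- have mp : measurable_fun [set: R] (fun x => (normal_pdf 0 1 x)%:E).
    by apply/measurable_EFinP; exact: measurable_normal_pdf.
  exact: (emeasurable_funM m2 mp).
- by move=> x _; rewrite mule_ge0// lee_fin normal_pdf_ge0.
apply: eq_integral => x _; rewrite F' -!EFinM; congr EFin.
rewrite !fctE /cst/= /F !normal_pdfE ?oner_neq0//= /normal_fun !subr0.
have -> : (- (sigma * x) ^+ 2 / (sigma ^+ 2 *+ 2) = - x ^+ 2 / (1 ^+ 2 *+ 2))%R.
  by field.
have -> : normal_peak 1 = (sigma * normal_peak sigma)%R.
  rewrite /normal_peak expr1n mul1r -mulrnAr sqrtrM ?sqr_ge0// sqrtr_sqr.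
  by rewrite gtr0_norm// invfM mulVKf.
by ring.
Qed.

End gaussian_variance.

(** * Independence *)

Section independence.
Local Open Scope ereal_scope.
Context d (T : measurableType d) (R : realType) (P : probability T R).

(** [T] already carries its own sigma-algebra, so measurability for a smaller one is stated through
    a generating family. The next lemma turns it into [measurable_fun] on a copy of [T], where the
    usual closure lemmas apply. *)
Definition measurable_wrt d' (E : measurableType d') (G : set (set T))
    (X : T -> E) : Prop :=
  forall B, measurable B -> <<s G >> (X @^-1` B).

Lemma measurable_wrtP d' (E : measurableType d') (G : set (set T))
    (X : T -> E) :
  measurable_wrt G X <->
  measurable_fun [set: g_sigma_algebraType G] (X : g_sigma_algebraType G -> E).
Proof.
split=> [GX _ B mB|mX B mB]; first by rewrite setTI; exact: GX.
by have := mX measurableT B mB; rewrite setTI.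
Qed.

Lemma measurable_wrt_comp d1 d2 (E1 : measurableType d1)
    (E2 : measurableType d2) (G : set (set T)) (X : T -> E1) (f : E1 -> E2) :
  measurable_fun setT f -> measurable_wrt G X -> measurable_wrt G (f \o X).
Proof.
move=> mf GX B mB; rewrite comp_preimage; apply: GX.
by rewrite -[X in measurable X]setTI; exact: mf.
Qed.

Lemma measurable_wrt_pair d1 d2 (E1 : measurableType d1)
    (E2 : measurableType d2) (G : set (set T)) (X : T -> E1) (Y : T -> E2) :
  measurable_wrt G X -> measurable_wrt G Y ->
  measurable_wrt G (fun w => (X w, Y w)).
Proof.
move=> /measurable_wrtP mX /measurable_wrtP mY.
by apply/measurable_wrtP; exact: measurable_fun_pair.
Qed.

(** Independence and law in a single formula: A = [setT] shows that [nu] is the law of [Y]. *)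
Definition indep_law d' (E : measurableType d') (G : set (set T))
    (Y : T -> E) (nu : set E -> \bar R) : Prop :=
  forall A B, <<s G >> A -> measurable B -> P (A `&` Y @^-1` B) = P A * nu B.

Section indep_product.
Context d1 d2 (E1 : measurableType d1) (E2 : measurableType d2).
Variables (G : set (set T)) (Z : T -> E1) (Y : T -> E2).
Variable nu : probability E2 R.
Hypotheses (Gm : G `<=` measurable) (GZ : measurable_wrt G Z).
Hypotheses (mY : measurable_fun setT Y) (indepY : indep_law G Y nu).

Let mZ : measurable_fun setT Z.
Proof.
move=> _ B mB; rewrite setTI.
exact: (smallest_sub (sigma_algebra_measurable T) Gm) (GZ mB).
Qed.

Let Z' := HB.pack_for {mfun T >-> E1} Z (isMeasurableFun.Build _ _ _ _ Z mZ).

Let ZY w := (Z w, Y w).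
Let mZY : measurable_fun setT ZY. Proof. exact: measurable_fun_pair. Qed.
Let ZY' := HB.pack_for {mfun T >-> (E1 * E2)%type} ZY
  (isMeasurableFun.Build _ _ _ _ ZY mZY).

Let lawE C : measurable C ->
  (distribution P Z' \x nu) C = distribution P ZY' C.
Proof.
apply: product_measure_unique => A B mA mB.
transitivity (P (Z @^-1` A `&` Y @^-1` B)); first by congr (P _).
by rewrite indepY//; exact: GZ.
Qed.

(** The law of (Z, Y) is the product of the law of Z and [nu], since they agree on rectangles;
    Tonelli then integrates Y out with Z frozen. *)
Lemma ge0_integral_indep (f : E1 * E2 -> \bar R) : measurable_fun setT f ->
  (forall p, 0 <= f p) ->
  \int[P]_w f (Z w, Y w) = \int[P]_w \int[nu]_y f (Z w, y).
Proof.
move=> mf f0; transitivity (\int[distribution P ZY']_p f p).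
  by rewrite ge0_integral_distribution.
transitivity (\int[distribution P Z' \x nu]_p f p).
  by apply: eq_measure_integral => C mC _; apply/esym/lawE.
rewrite fubini_tonelli1// ge0_integral_distribution//.
- exact: measurable_fun_fubini_tonelli_F.
- by move=> x; exact: integral_ge0.
Qed.

Lemma integrable_indep (f : E1 * E2 -> \bar R) : measurable_fun setT f ->
  \int[P]_w \int[nu]_y `|f (Z w, y)| < +oo ->
  P.-integrable setT (fun w => f (Z w, Y w)) /\
  \int[P]_w f (Z w, Y w) = \int[P]_w \int[nu]_y f (Z w, y).
Proof.
move=> mf foo.
have maf : measurable_fun setT (abse \o f) by exact: measurableT_comp.
have intf : P.-integrable setT (f \o ZY').
  apply/integrableP; split; first exact: measurableT_comp.
  apply: le_lt_trans foo; rewrite le_eqVlt; apply/orP; left; apply/eqP.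
  exact: (ge0_integral_indep maf (fun p => abse_ge0 _)).
have intm : (distribution P Z' \x nu).-integrable setT f.
  apply/integrable12ltyP => //.
  rewrite (@ge0_integral_distribution _ _ _ _ _ _ _
    (fun x => \int[nu]_y `|f (x, y)|))//.
  - by apply: (measurable_fun_fubini_tonelli_F (abse \o f)) => //=.
  - by move=> x; exact: integral_ge0.
split=> //; transitivity (\int[distribution P ZY']_p f p).
  by rewrite integral_distribution.
transitivity (\int[distribution P Z' \x nu]_p f p).
  by apply: eq_measure_integral => C mC _; apply/esym/lawE.
rewrite -integral12_prod_meas1//.
have intF := integrable_fubini_F intm.
rewrite integral_distribution//; first exact: measurable_fubini_F intm.
move/integrableP : intF => [mF Foo]; apply/integrableP; split.
  exact: measurableT_comp.
have maF : measurable_fun setT (abse \o fubini_F nu f).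
  exact: measurableT_comp.
apply: le_lt_trans Foo; rewrite le_eqVlt; apply/orP; left; apply/eqP/esym.
exact: (ge0_integral_distribution Z' maF (fun=> abse_ge0 _)).
Qed.

End indep_product.

Lemma Rintegral_indep_mul d' (E : measurableType d') (G : set (set T))
    (Z : T -> R) (Y : T -> E) (nu : probability E R) (phi : E -> R) :
  G `<=` measurable -> measurable_wrt G Z ->
  measurable_fun setT Y -> indep_law G Y nu -> measurable_fun setT phi ->
  P.-integrable setT (EFin \o Z) -> nu.-integrable setT (EFin \o phi) ->
  P.-integrable setT (fun w => (Z w * phi (Y w))%:E) /\
  (\int[P]_w (Z w * phi (Y w)) = (\int[P]_w Z w) * \int[nu]_y phi y)%R.
Proof.
move=> Gm GZ mY indepY mphi iZ iphi.
pose f (p : R * E) : \bar R := (p.1 * phi p.2)%:E.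
have mf : measurable_fun setT f.
  by apply/measurable_EFinP; apply: measurable_funM => //; exact: measurableT_comp.
have [mZ Zoo] := integrableP _ _ _ iZ; have [mphi' phioo] := integrableP _ _ _ iphi.
have fin_phi : \int[nu]_y (phi y)%:E \is a fin_num by exact: integrable_fin_num.
have fin_aphi : \int[nu]_y `|(phi y)%:E| \is a fin_num.
  by rewrite ge0_fin_numE// integral_ge0.
have foo : \int[P]_w \int[nu]_y `|f (Z w, y)| < +oo.
  rewrite (eq_integral (fun w => `|(Z w)%:E| * \int[nu]_y `|(phi y)%:E|)).
    rewrite ge0_integralZr//; last 2 first.
    - exact: measurableT_comp mZ.
    - exact: integral_ge0.
    by rewrite lte_mul_pinfty// ?integral_ge0// ge0_fin_numE// integral_ge0.
  move=> w _; rewrite -ge0_integralZl//; last exact: measurableT_comp mphi'.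
  by apply: eq_integral => y _; rewrite -abseM.
have [intf Ef] := integrable_indep Gm GZ mY indepY mf foo.
split=> //; rewrite /Rintegral Ef /f/=.
under eq_integral do (under eq_integral do rewrite EFinM; rewrite integralZl//).
rewrite -(fineK fin_phi) integralZr// fineM//.
exact: integrable_fin_num.
Qed.

End independence.

(** * Extension of independence from a pi-system *)

Section pi_lambda.
Local Open Scope ereal_scope.
Context d (T : measurableType d) (R : realType) (P : probability T R).

(** The finite measures P(. [&] D) and P(D) P agree on the pi-system [C], hence on the sigma-algebra
    that it generates. *)
Lemma indep_event_sigma (C : set (set T)) (D : set T) :
  C `<=` measurable -> setI_closed C -> C setT -> measurable D ->
  (forall A, C A -> P (A `&` D) = P A * P D) ->
  forall A, <<s C >> A -> P (A `&` D) = P A * P D.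
Proof.
move=> Cm CI CT mD CD A CA.
have fD : P D \is a fin_num by exact: fin_num_measure.
have D0 : (0 <= fine (P D))%R by exact: fine_ge0.
pose m2 := mscale (NngNum D0) P.
transitivity (mrestr P mD A) => //.
transitivity (m2 A); last by rewrite /m2 /mscale/= fineK// muleC.
apply: (g_sigma_algebra_measure_unique C Cm (fun=> setT)) => //.
- by rewrite bigcup_const//; exists 0%N.
- move=> B CB; transitivity (P (B `&` D)); first by [].
  by rewrite CD// [RHS]/(m2 B) /m2 /mscale/= fineK// muleC.
- move=> k; apply: (@le_lt_trans _ _ (P (setT `&` D))); first by [].
  by rewrite setTI ltey_eq fD.
Qed.

Lemma probability_eq_ae (N A B : set T) :
  measurable N -> measurable A -> measurable B -> P N = 0 ->
  A `\` N `<=` B -> B `\` N `<=` A -> P A = P B.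
Proof.
move=> mN mA mB PN AB BA.
have le (X Y : set T) : measurable X -> measurable Y -> X `\` N `<=` Y ->
    P X <= P Y.
  move=> mX mY XY; rewrite -[leRHS]adde0 -PN.
  apply: (@le_trans _ _ (P (Y `|` N))); last exact: measureU2.
  apply: le_measure; rewrite ?inE//; first exact: measurableU.
  by move=> x Xx; have [Nx|Nx] := pselect (N x); [right|left; exact: XY].
by apply/eqP; rewrite eq_le !le.
Qed.

End pi_lambda.

(** * Filtration of two Wiener processes *)

Section wiener_increments.
Local Open Scope ereal_scope.
Context d (T : measurableType d) (R : realType) (P : probability T R).
Variable W : R -> {RV P >-> R}.
Hypothesis wienerW : standard_wiener W.

Definition incr (s t : R) (w : T) : R := (W t w - W s w)%R.

Lemma measurable_incr s t : measurable_fun setT (incr s t).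
Proof. exact: measurable_funB. Qed.

Section grid.
Variables (n : nat) (u : nat -> R).
Hypothesis u0 : (0 <= u 0%N)%R.
Hypothesis u_nd : forall i, (i < n.+1)%N -> (u i <= u i.+1)%R.

Let X (i : nat) := incr (u i) (u i.+1).

Let mX i B : measurable B -> measurable (X i @^-1` B).
Proof. by move=> mB; rewrite -[_ @^-1` _]setTI; exact: measurable_incr. Qed.

Definition grid_events : set (set T) :=
  \bigcup_(i in [set i | (i < n)%N])
    preimage_set_system setT (incr (u i) (u i.+1)) measurable.

(** Finite conjunctions of conditions on the first n increments form a pi-system generating
    [grid_events]. On it, the product formula for n + 1 increments is the one for n increments times
    one more factor. *)
Lemma grid_events_indep A B : <<s grid_events >> A -> measurable B ->
  P (A `&` X n @^-1` B) = P A * P (X n @^-1` B).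
Proof.
pose C : set (set T) := [set A | exists2 Bs : nat -> set R,
  (forall i, measurable (Bs i)) &
  A = \bigcap_(i in [set i | (i < n)%N]) (X i @^-1` Bs i)].
have rect m (Bs : nat -> set R) : (m <= n.+1)%N ->
    (forall i, measurable (Bs i)) ->
    P (\bigcap_(i in [set i | (i < m)%N]) (X i @^-1` Bs i)) =
    \prod_(i < m) P (X i @^-1` Bs i).
  move=> mn mBs; apply: (wiener_indep_increments wienerW) => // i im.
  by apply: u_nd; exact: leq_trans mn.
have GC : <<s grid_events >> `<=` <<s C >>.
  apply: smallest_sub; first exact: smallest_sigma_algebra.
  move=> _ [i /= im [B' mB' <-]]; rewrite setTI; apply: sub_sigma_algebra.
  exists (fun j => if j == i then B' else setT).
    by move=> j; case: ifP.
  apply/seteqP; split => [w Bw j _|w /(_ i im)]; rewrite /= ?eqxx//.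
  by case: eqP => // ->.
move=> /GC CA mB; move: A CA; apply: indep_event_sigma.
- move=> _ [Bs mBs ->]; rewrite bigcap_mkord.
  by apply: bigsetI_measurable => i _; exact: mX.
- move=> _ _ [Bs mBs ->] [Bs' mBs' ->].
  exists (fun i => Bs i `&` Bs' i); first by move=> i; exact: measurableI.
  by rewrite -bigcapI.
- exists (fun=> setT) => //.
  by apply/seteqP; split.
- exact: mX.
move=> _ [Bs mBs ->].
pose Bs' i := if i == n then B else Bs i.
have mBs' i : measurable (Bs' i) by rewrite /Bs'; case: ifP.
have := rect n.+1 Bs' (leqnn _) mBs'.
have Bs'n : Bs' n = B by rewrite /Bs' eqxx.
rewrite big_ord_recr/= Bs'n.
have -> : \prod_(i < n) P (X i @^-1` Bs' i) = \prod_(i < n) P (X i @^-1` Bs i).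
  by apply: eq_bigr => i _; rewrite /Bs' ltn_eqF.
rewrite -(rect n Bs)// => <-; congr (P _).
apply/seteqP; split => [w [Bw Bnw] i/=|w Bw].
  rewrite ltnS leq_eqVlt /Bs'; case: eqP => [->//|_ /= ni].
  exact: Bw.
split; last by have := Bw n (ltnSn n); rewrite /= Bs'n.
by move=> i /= ni; have := Bw i (ltnW ni); rewrite /Bs' ltn_eqF.
Qed.

Lemma grid_events_wrt j : (j <= n)%N ->
  measurable_wrt grid_events (incr (u 0%N) (u j)).
Proof.
move=> jn; apply/measurable_wrtP; elim: j jn => [_|j IH jn].
  rewrite (_ : incr _ _ = cst 0%R) ?measurable_cst//.
  by apply/funext => w; rewrite /incr subrr.
rewrite (_ : incr _ _ = fun w => (incr (u 0%N) (u j) w + X j w)%R).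
  apply: measurable_funD; first exact: (IH (ltnW jn)).
  apply/measurable_wrtP => B mB; apply: sub_sigma_algebra.
  by exists j => //; exists B => //; rewrite setTI.
by apply/funext => w; rewrite /X /incr; ring.
Qed.

End grid.

(** With lists, concatenation gives the intersection, so cylinders form a pi-system. [V] is a
    parameter because the same list is read both for W and for [incr W 0]. *)
Definition cylinder (V : R -> T -> R) (l : seq (R * set R)) : set T :=
  foldr (fun p C => V p.1 @^-1` p.2 `&` C) setT l.

Definition cylinder_ok (u : R) (l : seq (R * set R)) : Prop :=
  foldr (fun p Q => [/\ (0 <= p.1 <= u)%R, measurable p.2 & Q]) True l.

Lemma cylinder_wrt (G : set (set T)) (V : R -> T -> R) (u : R) l :
  (forall r, r \in map fst l -> measurable_wrt G (V r)) ->
  cylinder_ok u l -> <<s G >> (cylinder V l).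
Proof.
pose sT := g_sigma_algebraType G.
elim: l => [_ _|p l IH GV [pu mp okl]] /=; first exact: (@measurableT _ sT).
apply: (@measurableI _ sT).
  by apply: GV => //; rewrite mem_head.
by apply: IH => // r rl; apply: GV; rewrite inE rl orbT.
Qed.

Lemma measurable_cylinder (V : R -> T -> R) (u : R) l :
  (forall r, measurable_fun setT (V r)) -> cylinder_ok u l ->
  measurable (cylinder V l).
Proof.
move=> mV okl; rewrite -(sigma_algebra_id (sigma_algebra_measurable T)).
apply: cylinder_wrt okl => r _ B mB.
by rewrite -[_ @^-1` _]setTI; apply: sub_sigma_algebra; exact: mV.
Qed.

(* The increments over the sorted times of a cylinder determine it once W_r is
   replaced by W_r - W_0, which changes it by a null set only. *)
Lemma increment_indep (u v : R) (A : set T) (B : set R) : (0 <= u)%R ->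
  (u <= v)%R -> process_events `[0%R, u] W A -> measurable B ->
  P (A `&` incr u v @^-1` B) = P A * P (incr u v @^-1` B).
Proof.
move=> u0 uv WA mB.
pose C : set (set T) := [set A | exists2 l, cylinder_ok u l & A = cylinder W l].
have mD : measurable (incr u v @^-1` B).
  by rewrite -[_ @^-1` _]setTI; exact: measurable_incr.
have {WA} : <<s C >> A.
  apply: (smallest_sub _ _ WA); first exact: smallest_sigma_algebra.
  move=> _ [r ru [B' mB' <-]]; apply: sub_sigma_algebra.
  exists [:: (r, B')] => /=; last by rewrite setTI setIT.
  by split => //; move: ru; rewrite /= in_itv.
move: A; apply: indep_event_sigma => //.
- by move=> _ [l okl ->]; exact: measurable_cylinder okl.
- move=> _ _ [l okl ->] [l' okl' ->]; exists (l ++ l').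
    by elim: l okl => //= p l IH [? ? /IH].
  elim: l {okl} => /= [|p l IH]; first by rewrite setTI.
  by rewrite -setIA IH.
- by exists [::].
move=> _ [l okl ->].
have [N [mN PN N0]] := wiener_start wienerW.
have W0 w : ~ N w -> W 0 w = 0%R by move=> Nw; apply: contrapT => /N0.
have cylE w : ~ N w -> cylinder W l w <-> cylinder (incr 0) l w.
  move=> /W0 Ww; elim: l {okl} => //= p l IH.
  by split=> -[pw /IH lw]; split=> //; move: pw; rewrite /= /incr Ww subr0.
have mV := measurable_cylinder (measurable_incr 0) okl.
have mW := measurable_cylinder (fun r => @measurable_funPT _ _ _ _ (W r)) okl.
have PE : P (cylinder W l `&` incr u v @^-1` B) =
    P (cylinder (incr 0) l `&` incr u v @^-1` B).
  apply: (@probability_eq_ae _ _ _ P N) => //; try exact: measurableI.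
    by move=> w [[lw Bw] Nw]; split=> //; exact/(cylE w Nw).
  by move=> w [[lw Bw] Nw]; split=> //; exact/(cylE w Nw).
have PE' : P (cylinder W l) = P (cylinder (incr 0) l).
  apply: (@probability_eq_ae _ _ _ P N) => //.
    by move=> w [lw Nw]; exact/(cylE w Nw).
  by move=> w [lw Nw]; exact/(cylE w Nw).
rewrite PE PE'.
(* The time 0 makes each W_r - W_0 expressible by grid increments, and u makes the sorted grid end
   at u, so that the increment over [u, v] comes right after it. The last index of the sorted list
   is [m], and [g] appends v; repeated times are harmless. *)
pose s0 : seq R := [:: 0%R, u & map fst l].
pose s := sort <=%R s0; pose m := (size l).+1.
have sz : size s = m.+1 by rewrite size_sort/= size_map.
have s_le r : r \in s0 -> (0 <= r <= u)%R.
  rewrite !inE => /or3P[/eqP ->|/eqP ->|]; rewrite ?lexx ?u0//.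
  elim: l okl {cylE mV mW PE PE' s0 s m sz} => //= p l IH [pu _ okl].
  by rewrite inE => /predU1P[->//|]; exact: IH.
have nd i j : (i <= j <= m)%N -> (s`_i <= s`_j)%R.
  move=> /andP[ij jm].
  apply: (sorted_leq_nth le_trans lexx 0%R (sort_sorted le_total s0)) => //;
    rewrite inE -/s sz ltnS//; exact: leq_trans ij jm.
have mem_s i : (i <= m)%N -> (0 <= s`_i <= u)%R.
  by move=> im; apply: s_le; rewrite -(mem_sort <=%R); apply: mem_nth; rewrite -/s sz.
have nth_s r : r \in s0 -> exists2 j, (j <= m)%N & s`_j = r.
  rewrite -(mem_sort <=%R) -/s => rs; exists (index r s); last exact: nth_index.
  by rewrite -ltnS -sz index_mem.
pose g i := if (i <= m)%N then s`_i else v.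
have gE i : (i <= m)%N -> g i = s`_i by rewrite /g => ->.
have gm : g m = u.
  rewrite gE//; apply/eqP; rewrite eq_le; have /andP[_ ->] := mem_s m (leqnn m).
  have [j jm <-] : exists2 j, (j <= m)%N & s`_j = u.
    by apply: nth_s; rewrite !inE eqxx orbT.
  by rewrite nd// jm leqnn.
have gSm : g m.+1 = v by rewrite /g ltnn.
have g0 : (0 <= g 0%N)%R by rewrite gE//; have /andP[] := mem_s 0%N (leq0n m).
have g_nd i : (i < m.+1)%N -> (g i <= g i.+1)%R.
  rewrite ltnS leq_eqVlt => /predU1P[->|im]; first by rewrite gm gSm.
  by rewrite !gE ?(ltnW im)//; apply: nd; rewrite leqnSn.
have := grid_events_indep g0 g_nd (A := cylinder (incr 0) l) _ mB.
rewrite gm gSm; apply; apply: (cylinder_wrt _ okl) => r rl.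
have [j jm sj] : exists2 j, (j <= m)%N & s`_j = r.
  by apply: nth_s; rewrite !inE rl !orbT.
have [k km sk] : exists2 k, (k <= m)%N & s`_k = 0%R.
  by apply: nth_s; rewrite !inE eqxx.
apply/measurable_wrtP.
(* Subtracting the increment up to the index k of time 0 spares a proof that the sorted list starts
   with 0. *)
rewrite (_ : incr 0 r = fun w => (incr (g 0%N) (g j) w - incr (g 0%N) (g k) w)%R).
  by apply: measurable_funB; apply/measurable_wrtP; exact: grid_events_wrt.
by apply/funext => w; rewrite /incr !gE// sj sk opprB addrA subrK.
Qed.

End wiener_increments.

Section joint_filtration.
Local Open Scope ereal_scope.
Context d (T : measurableType d) (R : realType) (P : probability T R).

(** Two separate horizons: to integrate out the increments of both processes over one interval
    successively, W1 must be known up to the right end while W2 is known up to the left end only. *)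
Definition joint_events (W1 W2 : R -> {RV P >-> R}) (u1 u2 : R) :
    set (set T) :=
  process_events `[0%R, u1] W1 `|` process_events `[0%R, u2] W2.

Lemma process_events_measurable (D : set R) (W : R -> {RV P >-> R}) :
  process_events D W `<=` measurable.
Proof.
apply: smallest_sub; first exact: sigma_algebra_measurable.
move=> _ [r _ [B mB <-]].
exact: (@measurable_funPT _ _ _ _ (W r)).
Qed.

Lemma joint_events_measurable (W1 W2 : R -> {RV P >-> R}) (u1 u2 : R) :
  joint_events W1 W2 u1 u2 `<=` measurable.
Proof. by move=> A [] /process_events_measurable. Qed.

Lemma process_events_sub (D E : set R) (W : R -> {RV P >-> R}) :
  D `<=` E -> process_events D W `<=` process_events E W.
Proof. by move=> DE; apply: sub_sigma_algebra2; exact: bigcup_subset. Qed.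

Lemma process_events_wrt (D : set R) (W : R -> {RV P >-> R}) (r : R) :
  D r -> measurable_wrt (\bigcup_(r in D) rv_events (W r)) (W r).
Proof.
by move=> Dr B mB; apply: sub_sigma_algebra; exists r => //; exists B => //;
  rewrite setTI.
Qed.

Lemma process_events_incr (D : set R) (W : R -> {RV P >-> R}) (s t : R) :
  D s -> D t -> measurable_wrt (\bigcup_(r in D) rv_events (W r)) (incr W s t).
Proof.
move=> Ds Dt; apply/measurable_wrtP.
by apply: measurable_funB; apply/measurable_wrtP; exact: process_events_wrt.
Qed.

Lemma independent_processesC (W1 W2 : R -> {RV P >-> R}) :
  independent_processes W1 W2 -> independent_processes W2 W1.
Proof. by move=> indep A B WA WB; rewrite setIC muleC indep. Qed.

(** It suffices to treat A1 [&] A2 with A1 from W1 and A2 from W2. Independence of the processes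
    splits off A1 both from A2 and from A2 [&] the increment event; within W2, [increment_indep]
    splits off A2. *)
Lemma joint_events_indep (W1 W2 : R -> {RV P >-> R}) (u1 u2 v : R) :
  standard_wiener W2 -> independent_processes W1 W2 ->
  (0 <= u2)%R -> (u2 < v)%R ->
  indep_law P (joint_events W1 W2 u1 u2) (incr W2 u2 v)
    (normal_prob 0 (Num.sqrt (v - u2))).
Proof.
move=> wW2 indep u20 u2v A B GA mB.
have lawB : normal_prob 0 (Num.sqrt (v - u2)) B = P (incr W2 u2 v @^-1` B).
  by rewrite -(wiener_normal_increments wW2).
rewrite lawB.
pose C : set (set T) := [set A | exists2 A1, process_events `[0%R, u1] W1 A1 &
  exists2 A2, process_events `[0%R, u2] W2 A2 & A = A1 `&` A2].
have PT D W : process_events D W setT.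
  exact: (@measurableT _ (g_sigma_algebraType (\bigcup_(r in D) rv_events (W r)))).
have PI D W A1 A2 : process_events D W A1 -> process_events D W A2 ->
    process_events D W (A1 `&` A2).
  exact: (@measurableI _ (g_sigma_algebraType (\bigcup_(r in D) rv_events (W r)))).
have {GA} : <<s C >> A.
  apply: (smallest_sub _ _ GA); first exact: smallest_sigma_algebra.
  move=> A' [WA|WA]; apply: sub_sigma_algebra.
    by exists A' => //; exists setT => //; rewrite setIT.
  by exists setT => //; exists A' => //; rewrite setTI.
move: A; apply: indep_event_sigma.
- move=> _ [A1 WA1 [A2 WA2 ->]].
  by apply: measurableI; [exact: process_events_measurable WA1|
    exact: process_events_measurable WA2].
- move=> _ _ [A1 WA1 [A2 WA2 ->]] [A3 WA3 [A4 WA4 ->]].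
  exists (A1 `&` A3); first exact: PI.
  by exists (A2 `&` A4); [exact: PI|rewrite setIACA].
- by exists setT => //; exists setT => //; rewrite setIT.
- by rewrite -[_ @^-1` _]setTI; exact: measurable_incr.
move=> _ [A1 WA1 [A2 WA2 ->]].
have le0y (u : R) : `[0%R, u] `<=` `[0%R, +oo[%classic.
  by move=> x /=; rewrite !in_itv/= andbT => /andP[].
have WB : process_events `[0%R, +oo[%classic W2 (incr W2 u2 v @^-1` B).
  by apply: process_events_incr => //=; rewrite in_itv/= andbT// ltW// (le_lt_trans u20).
have {}WA1 := process_events_sub (@le0y u1) WA1.
have WA2' := process_events_sub (@le0y u2) WA2.
rewrite -setIA (indep _ _ WA1 (PI _ _ _ _ _ _ _ _ WA2' WB)) (indep _ _ WA1 WA2').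
by rewrite (increment_indep wW2 u20 (ltW u2v))// muleA.
Qed.

End joint_filtration.

(** * Ito isometry *)

Section has_integral.
Local Open Scope ereal_scope.
Context d (T : measurableType d) (R : realType).
Variable mu : {measure set T -> \bar R}.
Implicit Types (X Y : T -> R) (a b : R).

(** Integrability travels with a real value, so that finite linear combinations need no side
    conditions on extended reals. *)
Definition has_integral X a : Prop :=
  mu.-integrable setT (fun w => (X w)%:E) /\ \int[mu]_w (X w)%:E = a%:E.

Lemma has_integral_eq X Y a : X =1 Y -> has_integral X a -> has_integral Y a.
Proof. by move=> /funext ->. Qed.

Lemma has_integral_fine X : mu.-integrable setT (fun w => (X w)%:E) ->
  has_integral X (fine (\int[mu]_w (X w)%:E)).
Proof. by move=> iX; split=> //; rewrite fineK//; exact: integrable_fin_num. Qed.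

Lemma has_integral_ge0 X a : measurable_fun setT X -> (forall w, (0 <= X w)%R) ->
  \int[mu]_w (X w)%:E = a%:E -> has_integral X a.
Proof.
move=> mX X0 Xa; split=> //; apply/integrableP; split; first exact/measurable_EFinP.
under eq_integral do rewrite gee0_abs ?lee_fin//.
by rewrite Xa ltry.
Qed.

Lemma has_integral0 : has_integral (fun=> 0%R) 0%R.
Proof. by split; [exact: integrable0|rewrite integral0]. Qed.

Lemma has_integralD X Y a b : has_integral X a -> has_integral Y b ->
  has_integral (fun w => X w + Y w)%R (a + b)%R.
Proof.
move=> [iX Xa] [iY Yb]; split; first exact: integrableD iX iY.
by under eq_integral do rewrite EFinD; rewrite integralD// Xa Yb.
Qed.

Lemma has_integralZ c X a : has_integral X a ->
  has_integral (fun w => c * X w)%R (c * a)%R.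
Proof.
move=> [iX Xa]; split; first exact: integrableZl iX.
by under eq_integral do rewrite EFinM; rewrite integralZl// Xa.
Qed.

Lemma has_integral_sum n (X : nat -> T -> R) (a : nat -> R) :
  (forall i, (i < n)%N -> has_integral (X i) (a i)) ->
  has_integral (fun w => \sum_(i < n) X i w)%R (\sum_(i < n) a i)%R.
Proof.
elim: n => [_|n IH iX].
  rewrite big_ord0; apply: has_integral_eq has_integral0 => w.
  by rewrite big_ord0.
rewrite big_ord_recr/=.
apply: (@has_integral_eq (fun w => \sum_(i < n) X i w + X n w)%R).
  by move=> w; rewrite big_ord_recr.
by apply: has_integralD; [apply: IH => i ni; exact/iX/ltnW|exact: iX].
Qed.

End has_integral.

Section square_integrable.
Local Open Scope ereal_scope.
Context d (T : measurableType d) (R : realType) (P : probability T R).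
Implicit Types X Y : T -> R.

Definition sq_integrable X : Prop :=
  measurable_fun setT X /\ \int[P]_w (X w ^+ 2)%:E < +oo.

Lemma sq_integrableP X :
  sq_integrable X <->
  measurable_fun setT X /\ P.-integrable setT (fun w => (X w ^+ 2)%:E).
Proof.
split=> -[mX Xoo]; split=> //; last first.
  have /integrableP[_] := Xoo; apply: le_lt_trans.
  by under [leRHS]eq_integral do rewrite gee0_abs ?lee_fin ?sqr_ge0//.
apply/integrableP; split; first exact/measurable_EFinP/measurable_funX.
by under eq_integral do rewrite gee0_abs ?lee_fin ?sqr_ge0//.
Qed.

Lemma sq_integrableM X Y : sq_integrable X -> sq_integrable Y ->
  P.-integrable setT (fun w => (X w * Y w)%:E).
Proof.
move=> /sq_integrableP[mX iX] /sq_integrableP[mY iY].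
apply: (le_integrable _ _ _ (integrableD measurableT iX iY)) => //.
  exact/measurable_EFinP/measurable_funM.
move=> w _ /=; rewrite lee_fin (ger0_norm (addr_ge0 (sqr_ge0 _) (sqr_ge0 _))).
rewrite ler_norml; apply/andP; split.
  by have := sqr_ge0 (X w + Y w); nra.
by have := sqr_ge0 (X w - Y w); nra.
Qed.

Lemma sq_integrable_cst1 : sq_integrable (cst 1%R).
Proof.
split=> //; under eq_integral do rewrite /= expr1n.
by rewrite integral_cst//= mul1e (le_lt_trans (probability_le1 P measurableT))// ltry.
Qed.

Lemma sq_integrable_integrable X : sq_integrable X ->
  P.-integrable setT (fun w => (X w)%:E).
Proof.
move=> sX; have := sq_integrableM sX sq_integrable_cst1.
by under eq_fun do rewrite mulr1.
Qed.

Lemma sq_integrableD X Y : sq_integrable X -> sq_integrable Y ->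
  sq_integrable (fun w => X w + Y w)%R.
Proof.
move=> sX sY; have iXY := sq_integrableM sX sY.
move: sX sY => /sq_integrableP[mX iX] /sq_integrableP[mY iY].
apply/sq_integrableP; split; first exact: measurable_funD.
have := integrableD measurableT (integrableD measurableT iX iY)
  (integrableD measurableT iXY iXY).
by congr (integrable _ _ _); apply/funext => w /=; congr EFin; ring.
Qed.

Lemma sq_integrableZ c X : sq_integrable X -> sq_integrable (fun w => c * X w)%R.
Proof.
move=> /sq_integrableP[mX iX]; apply/sq_integrableP; split.
  exact: measurable_funM.
by have := integrableZl measurableT (c ^+ 2) iX; under eq_fun do rewrite -EFinM -exprMn.
Qed.

End square_integrable.

Section normal_moments.
Local Open Scope ereal_scope.
Context {R : realType} (sigma : R).
Hypothesis sigma0 : (0 < sigma)%R.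
Notation N := (@normal_prob R 0 sigma).

Lemma has_integral_normal_sqr :
  has_integral N (fun x => x ^+ 2)%R (std_variance * sigma ^+ 2)%R.
Proof.
apply: has_integral_ge0; [exact: measurable_funX|by move=> x; exact: sqr_ge0|].
exact: integral_normal_prob_sqr.
Qed.

(** This is the quarter turn c = 0, s = 1, which sends (x, y) to (y, - x), applied to a function of
    the second coordinate; the other coordinate integrates to 1. *)
Lemma integral_normal_oppr (f : R -> \bar R) :
  measurable_fun setT f -> (forall x, 0 <= f x) ->
  \int[N]_x f (- x)%R = \int[N]_x f x.
Proof.
move=> mf f0.
have cst_int (c : \bar R) : 0 <= c -> \int[N]_x (fun=> c) x = c.
  move=> c0; rewrite integral_cst//=.
  by rewrite (_ : N setT = 1) ?mule1//; exact: (@probability_setT _ _ _ N).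
have Ef (g : R -> \bar R) : measurable_fun setT g -> (forall x, 0 <= g x) ->
    \int[N]_x \int[N]_y g x = \int[N]_x g x.
  by move=> mg g0; apply: eq_integral => x _; exact: cst_int.
have mfN : measurable_fun setT (fun x : R => f (- x)%R).
  by apply: (measurableT_comp mf); exact: oppr_measurable.
have := @ge0_integral_normal_prob_rotation R sigma (lt0r_neq0 sigma0) 0 1
  (fun p => f (- p.2)%R).
rewrite expr0n expr1n add0r addr0 => /(_ erefl ltr01) H.
have {H} := H (measurableT_comp mfN measurable_snd) (fun=> f0 _).
rewrite /rotation /=.
under eq_integral do under eq_integral do rewrite mulN1r mul0r addr0 opprK.
rewrite Ef// => ->.
rewrite cst_int//; first exact: integral_ge0.
Qed.

(** The reflection exchanges the positive and negative parts of x, whose common integral is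
    finite. *)
Lemma has_integral_normal_id : has_integral N (fun x => x) 0%R.
Proof.
have sN : sq_integrable N (fun x => x).
  by split=> //; have [_ ->] := has_integral_normal_sqr; rewrite ltry.
have iN := sq_integrable_integrable sN; split=> //.
rewrite integralE.
have -> : \int[N]_x ((fun x => x%:E)^\- x) = \int[N]_x ((fun x => x%:E)^\+ x).
  have mp : measurable_fun [set: R] (fun x : R => x%:E)^\+.
    exact/measurable_funepos/measurable_EFinP.
  transitivity (\int[N]_x (fun x : R => x%:E)^\+ (- x)%R).
    by apply: eq_integral => x _; rewrite funenegE funeposE.
  exact: integral_normal_oppr.
rewrite subee//; apply: integrable_pos_fin_num => //.
Qed.

End normal_moments.

Section brownian.
Local Open Scope ereal_scope.
Context d (T : measurableType d) (R : realType) (P : probability T R).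

(** The filtration may be larger than that of W: both Wiener processes satisfy this for the joint
    filtration, so that each can be integrated against the other. *)
Record brownian_wrt (F : R -> set (set T)) (W : R -> {RV P >-> R}) : Prop := {
  brownian_measurable : forall s, F s `<=` measurable ;
  brownian_mono : forall s t, (s <= t)%R -> F s `<=` F t ;
  brownian_adapted : forall s, (0 <= s)%R -> measurable_wrt (F s) (W s) ;
  brownian_indep : forall s t, (0 <= s)%R -> (s < t)%R ->
    indep_law P (F s) (incr W s t) (normal_prob 0 (Num.sqrt (t - s))) }.

Lemma measurable_wrt_mono d' (E : measurableType d') (F G : set (set T))
    (X : T -> E) :
  F `<=` G -> measurable_wrt F X -> measurable_wrt G X.
Proof. by move=> FG FX B mB; exact: sub_sigma_algebra2 FG _ (FX B mB). Qed.

Section isometry.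
Variables (F : R -> set (set T)) (W : R -> {RV P >-> R}).
Hypothesis bW : brownian_wrt F W.

Let Fm s : F s `<=` measurable := @brownian_measurable _ _ bW s.

Lemma adapted_mono (s t : R) d' (E : measurableType d') (X : T -> E) :
  (s <= t)%R -> measurable_wrt (F s) X -> measurable_wrt (F t) X.
Proof. by move=> st; apply: measurable_wrt_mono; exact: (brownian_mono bW). Qed.

Lemma adaptedM (s : R) (X Y : T -> R) :
  measurable_wrt (F s) X -> measurable_wrt (F s) Y ->
  measurable_wrt (F s) (fun w => X w * Y w)%R.
Proof.
move=> /measurable_wrtP mX /measurable_wrtP mY.
by apply/measurable_wrtP; exact: measurable_funM.
Qed.

Lemma adapted_incr (r s t : R) : (0 <= r <= t)%R -> (0 <= s <= t)%R ->
  measurable_wrt (F t) (incr W r s).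
Proof.
move=> /andP[r0 rt] /andP[s0 st]; apply/measurable_wrtP; apply: measurable_funB.
  by apply/measurable_wrtP; exact: adapted_mono st (brownian_adapted bW s0).
by apply/measurable_wrtP; exact: adapted_mono rt (brownian_adapted bW r0).
Qed.

Lemma has_integral_indep_incr (s t : R) (U : T -> R) (phi : R -> R) (u v : R) :
  (0 <= s)%R -> (s < t)%R -> measurable_wrt (F s) U -> has_integral P U u ->
  measurable_fun setT phi ->
  has_integral (normal_prob 0 (Num.sqrt (t - s))) phi v ->
  has_integral P (fun w => U w * phi (incr W s t w))%R (u * v)%R.
Proof.
move=> s0 st FU [iU Uu] mphi [iphi phiv].
have [iM EM] := @Rintegral_indep_mul _ _ _ P _ (measurableTypeR R) _ _ _
  (normal_prob 0 (Num.sqrt (t - s))) _ (@Fm s) FU (measurable_incr W s t)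
  (brownian_indep bW s0 st) mphi iU iphi.
split=> //; rewrite -[LHS]fineK; last exact: integrable_fin_num.
by congr EFin; move: EM; rewrite /Rintegral Uu phiv.
Qed.

Lemma has_integral_incr (s t : R) (U : T -> R) (u : R) :
  (0 <= s <= t)%R -> measurable_wrt (F s) U -> has_integral P U u ->
  has_integral P (fun w => U w * incr W s t w)%R 0%R.
Proof.
move=> /andP[s0]; rewrite le_eqVlt => /predU1P[<-|st] FU Uu.
  apply: has_integral_eq (has_integral0 P) => w.
  by rewrite /incr subrr mulr0.
rewrite -(mulr0 u); apply: (has_integral_indep_incr (phi := fun x => x)) => //.
by apply: has_integral_normal_id; rewrite sqrtr_gt0 subr_gt0.
Qed.

Lemma has_integral_incr_sqr (s t : R) (U : T -> R) (u : R) :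
  (0 <= s <= t)%R -> measurable_wrt (F s) U -> has_integral P U u ->
  has_integral P (fun w => U w * incr W s t w ^+ 2)%R
    (u * (std_variance * (t - s)))%R.
Proof.
move=> /andP[s0]; rewrite le_eqVlt => /predU1P[<-|st] FU Uu.
  rewrite subrr !mulr0; apply: has_integral_eq (has_integral0 P) => w.
  by rewrite /incr subrr expr0n mulr0.
have ts : (0 < t - s)%R by rewrite subr_gt0.
apply: (has_integral_indep_incr (phi := fun x => x ^+ 2)%R) => //.
rewrite -[X in (std_variance * X)%R](sqr_sqrtr (ltW ts)); apply: has_integral_normal_sqr.
by rewrite sqrtr_gt0.
Qed.

Lemma sq_integrable_mul_incr (s t : R) (U : T -> R) : (0 <= s <= t)%R ->
  measurable_wrt (F s) U -> sq_integrable P U ->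
  sq_integrable P (fun w => U w * incr W s t w)%R.
Proof.
move=> st FU sU; have [mU iU] := (sq_integrableP _ _).1 sU.
have FU2 := adaptedM FU FU.
apply/sq_integrableP; split.
  by apply: measurable_funM => //; exact: measurable_incr.
have [+ _] := has_integral_incr_sqr st FU2 (has_integral_fine iU).
by under [in X in _ -> X]eq_fun do rewrite exprMn expr2.
Qed.

Notation lam := (@lebesgue_measure R).

(** The L^2(ds) inner product of the indicators of ]a, b] and ]c, e]. *)
Definition overlap (a b c e : R) : R :=
  fine (lam (`]a, b] `&` `]c, e]%classic)).

Lemma overlapC a b c e : overlap a b c e = overlap c e a b.
Proof. by rewrite /overlap setIC. Qed.

Let overlap_itv a b c e x y : (x <= y)%R ->
  `]a, b] `&` `]c, e] = `]x, y]%classic -> overlap a b c e = (y - x)%R.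
Proof.
move=> xy; rewrite /overlap => ->; rewrite lebesgue_measure_itv/= lte_fin.
by move: xy; rewrite le_eqVlt => /predU1P[->|->//]; rewrite ltxx subrr.
Qed.

(** Cut both intervals at c and at m = min(b, e). The increment over [a, c] is known at time c, and
    one beyond m is independent of the past of m, so their products have mean zero; only the square
    over [c, m] contributes. If b <= c, the whole first factor is known at time c. *)
Let has_integral_incr2_le (a b c e : R) (X Y : T -> R) (v : R) :
  (0 <= a <= b)%R -> (c <= e)%R -> (a <= c)%R ->
  measurable_wrt (F a) X -> measurable_wrt (F c) Y ->
  sq_integrable P X -> sq_integrable P Y ->
  has_integral P (fun w => X w * Y w)%R v ->
  has_integral P (fun w => (X w * incr W a b w) * (Y w * incr W c e w))%R
    (std_variance * (overlap a b c e * v))%R.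
Proof.
move=> /andP[a0 ab] ce ac FX FY sX sY XYv.
have c0 := le_trans a0 ac; have e0 := le_trans c0 ce.
have FXc := adapted_mono ac FX.
have Fac : measurable_wrt (F c) (incr W a c).
  by apply: adapted_incr; rewrite ?a0 ?c0 ?ac ?lexx.
have aac : (0 <= a <= c)%R by rewrite a0.
have cce : (0 <= c <= e)%R by rewrite c0.
have [bc|cb] := leP b c.
  rewrite (@overlap_itv _ _ _ _ c c)//; last first.
    apply/seteqP; split=> x /=; rewrite !in_itv/=.
      move=> [/andP[_ xb] /andP[cx _]].
      by have := lt_le_trans cx (le_trans xb bc); rewrite ltxx.
    by move=> /andP[cx xc]; have := lt_le_trans cx xc; rewrite ltxx.
  rewrite subrr mul0r mulr0.
  have aab : (0 <= a <= b)%R by rewrite a0.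
  have iX := sq_integrableM (sq_integrable_mul_incr aab FX sX) sY.
  have FXY : measurable_wrt (F c) (fun w => X w * incr W a b w * Y w)%R.
    apply: adaptedM => //; apply: adaptedM => //.
    by apply: adapted_incr; rewrite ?a0 ?ac// bc (le_trans a0 ab).
  apply: has_integral_eq (has_integral_incr cce FXY (has_integral_fine iX)) => w.
  by rewrite mulrA.
pose m := Num.min b e.
have cm : (c <= m)%R by rewrite le_min (ltW cb).
have m0 := le_trans c0 cm.
have ccm : (0 <= c <= m)%R by rewrite c0.
rewrite (@overlap_itv _ _ _ _ c m)//; last first.
  apply/seteqP; split=> x /=; rewrite !in_itv/= le_min.
    by move=> [/andP[_ ->] /andP[-> ->]].
  by move=> /and3P[cx -> ->]; rewrite cx (le_lt_trans ac cx).
have FXY : measurable_wrt (F c) (fun w => X w * Y w)%R by exact: adaptedM.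
have iX1 := sq_integrableM (sq_integrable_mul_incr aac FX sX) sY.
have FX1 : measurable_wrt (F c) (fun w => X w * incr W a c w * Y w)%R.
  by apply: adaptedM => //; exact: adaptedM.
have H1 := has_integral_incr cce FX1 (has_integral_fine iX1).
have H2 := has_integral_incr_sqr ccm FXY XYv.
have FXm : measurable_wrt (F m) (fun w => X w * Y w * incr W c m w)%R.
  apply: adaptedM; first exact: adapted_mono cm FXY.
  by apply: adapted_incr; rewrite ?c0 ?m0 ?cm ?lexx.
have H3 := has_integral_incr ccm FXY XYv.
have [be|eb] := leP b e.
  have mb : m = b by rewrite /m; apply/min_idPl.
  have mme : (0 <= m <= e)%R by rewrite m0 mb.
  have H4 := has_integral_incr mme FXm H3.
  rewrite [X in has_integral _ _ X](_ : _ =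
    0 + (v * (std_variance * (m - c)) + 0))%R; last by ring.
  apply: has_integral_eq (has_integralD H1 (has_integralD H2 H4)) => w.
  by rewrite /incr mb; ring.
have me : m = e by rewrite /m; apply/min_idPr/ltW.
have mmb : (0 <= m <= b)%R by rewrite m0 me ltW.
have H4 := has_integral_incr mmb FXm H3.
rewrite [X in has_integral _ _ X](_ : _ =
  0 + (v * (std_variance * (m - c)) + 0))%R; last by ring.
apply: has_integral_eq (has_integralD H1 (has_integralD H2 H4)) => w.
by rewrite /incr me; ring.
Qed.

Lemma has_integral_incr2 (a b c e : R) (X Y : T -> R) (v : R) :
  (0 <= a <= b)%R -> (0 <= c <= e)%R ->
  measurable_wrt (F a) X -> measurable_wrt (F c) Y ->
  sq_integrable P X -> sq_integrable P Y ->
  has_integral P (fun w => X w * Y w)%R v ->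
  has_integral P (fun w => (X w * incr W a b w) * (Y w * incr W c e w))%R
    (std_variance * (overlap a b c e * v))%R.
Proof.
move=> aab cce FX FY sX sY XYv; have [ac|/ltW ca] := leP a c.
  by apply: has_integral_incr2_le => //; case/andP: cce.
rewrite overlapC; apply: has_integral_eq (has_integral_incr2_le cce _ ca FY FX sY sX _).
- by move=> w; rewrite mulrC.
- by case/andP: aab.
- by apply: has_integral_eq XYv => w; rewrite mulrC.
Qed.

(** Both squares expand into double sums that match term by term through [overlap]; hence the
    intervals need be neither ordered nor disjoint. *)
Lemma ito_isometry n (X : nat -> T -> R) (a b : nat -> R) :
  (forall i, (i < n)%N -> [/\ (0 <= a i <= b i)%R, measurable_wrt (F (a i)) (X i)
     & sq_integrable P (X i)]) ->
  \int[P]_w ((\sum_(i < n) X i w * incr W (a i) (b i) w) ^+ 2)%:E =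
  std_variance%:E * \int[P]_w \int[lam]_s
    ((\sum_(i < n) X i w * \1_(`]a i, b i]) s) ^+ 2)%:E.
Proof.
move=> H.
have sqE (x : nat -> R) : ((\sum_(i < n) x i) ^+ 2 =
    \sum_(i < n) \sum_(j < n) x i * x j)%R.
  by rewrite expr2 mulr_suml; apply: eq_bigr => i _; rewrite mulr_sumr.
pose v i j := fine (\int[P]_w (X i w * X j w)%:E).
have Hv i j : (i < n)%N -> (j < n)%N -> has_integral P (fun w => X i w * X j w)%R (v i j).
  move=> ni nj; apply: has_integral_fine; apply: sq_integrableM.
    by case: (H i ni).
  by case: (H j nj).
have [_ E1] : has_integral P
    (fun w => (\sum_(i < n) X i w * incr W (a i) (b i) w) ^+ 2)%R
    (\sum_(i < n) \sum_(j < n)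
      std_variance * (overlap (a i) (b i) (a j) (b j) * v i j))%R.
  pose G i j w := (X i w * incr W (a i) (b i) w * (X j w * incr W (a j) (b j) w))%R.
  apply: (@has_integral_eq _ _ _ _
      (fun w => \sum_(i < n) \sum_(j < n) G i j w)%R).
    by move=> w; rewrite (sqE (fun i => X i w * incr W (a i) (b i) w)%R).
  apply: (@has_integral_sum _ _ _ _ _ (fun i w => \sum_(j < n) G i j w)%R
    (fun i => \sum_(j < n) std_variance * (overlap (a i) (b i) (a j) (b j) * v i j))%R).
  move=> i ni; apply: (@has_integral_sum _ _ _ _ _ (G i)
    (fun j => std_variance * (overlap (a i) (b i) (a j) (b j) * v i j))%R).
  move=> j nj; have [? ? ?] := H i ni; have [? ? ?] := H j nj.
  by apply: has_integral_incr2 => //; exact: Hv.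
rewrite E1.
have E2 w : \int[lam]_s ((\sum_(i < n) X i w * \1_(`]a i, b i]) s) ^+ 2)%:E =
   (\sum_(i < n) \sum_(j < n) overlap (a i) (b i) (a j) (b j) * (X i w * X j w))%:E.
  pose G i j (s : measurableTypeR R) := (X i w * X j w *
    \1_(`]a i, b i] `&` `]a j, b j]%classic) s)%R.
  suff [_] : has_integral lam
      (fun s => (\sum_(i < n) X i w * \1_(`]a i, b i]) s) ^+ 2)%R
      (\sum_(i < n) \sum_(j < n)
         overlap (a i) (b i) (a j) (b j) * (X i w * X j w))%R by [].
  apply: (@has_integral_eq _ _ _ lam
      (fun s => \sum_(i < n) \sum_(j < n) G i j s)%R).
    move=> s; rewrite (sqE (fun i => X i w * \1_(`]a i, b i]) s)%R).
    apply: eq_bigr => i _; apply: eq_bigr => j _.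
    by rewrite /G indicI/=; ring.
  apply: (@has_integral_sum _ _ _ lam _ (fun i s => \sum_(j < n) G i j s)%R
    (fun i => \sum_(j < n) overlap (a i) (b i) (a j) (b j) * (X i w * X j w))%R).
  move=> i ni; apply: (@has_integral_sum _ _ _ lam _ (G i)
    (fun j => overlap (a i) (b i) (a j) (b j) * (X i w * X j w))%R).
  move=> j nj; rewrite mulrC; apply: has_integralZ.
  have mI : measurable (`]a i, b i] `&` `]a j, b j]%classic) by exact: measurableI.
  apply: has_integral_ge0 => //.
  rewrite integral_indic// setIT /overlap fineK//.
  rewrite ge0_fin_numE//; apply: (@le_lt_trans _ _ (lam `]a i, b i]%classic)).
    by apply: le_measure; rewrite ?inE//; apply: subIset; left.
  by rewrite lebesgue_measure_itv/=; case: ifP => _; rewrite ?ltry.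
under eq_integral do rewrite E2.
have [_ ->] : has_integral P (fun w => \sum_(i < n) \sum_(j < n)
    overlap (a i) (b i) (a j) (b j) * (X i w * X j w))%R
    (\sum_(i < n) \sum_(j < n) overlap (a i) (b i) (a j) (b j) * v i j)%R.
  apply: (@has_integral_sum _ _ _ _ _ (fun i w => \sum_(j < n)
      overlap (a i) (b i) (a j) (b j) * (X i w * X j w))%R
    (fun i => \sum_(j < n) overlap (a i) (b i) (a j) (b j) * v i j)%R).
  move=> i ni; apply: (@has_integral_sum _ _ _ _ _ (fun j w =>
      overlap (a i) (b i) (a j) (b j) * (X i w * X j w))%R
    (fun j => overlap (a i) (b i) (a j) (b j) * v i j)%R).
  by move=> j nj; apply: has_integralZ; exact: Hv.
rewrite -EFinM mulr_sumr; congr EFin; apply: eq_bigr => i _.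
by rewrite mulr_sumr.
Qed.

End isometry.

End brownian.

(** * Uniqueness of the Ito integral and Riemann sums *)

Section sq_distance.
Local Open Scope ereal_scope.
Context d (T : measurableType d) (R : realType).
Variable mu : {measure set T -> \bar R}.

Definition sq_norm (X : T -> R) : \bar R := \int[mu]_w (X w ^+ 2)%:E.

Lemma sq_norm_ge0 X : 0 <= sq_norm X.
Proof. by apply: integral_ge0 => w _; rewrite lee_fin sqr_ge0. Qed.

Lemma measurable_sqr (X : T -> R) : measurable_fun setT X ->
  measurable_fun setT (fun w => (X w ^+ 2)%:E).
Proof. by move=> mX; exact/measurable_EFinP/measurable_funX. Qed.

(** From (x + y)^2 <= 2 x^2 + 2 y^2. Used in place of Minkowski, it avoids square roots and
    finiteness conditions. *)
Lemma sq_norm_triangle (X Y Z : T -> R) : measurable_fun setT X ->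
  measurable_fun setT Y -> measurable_fun setT Z ->
  sq_norm (fun w => X w - Z w)%R <=
  2%:E * (sq_norm (fun w => X w - Y w)%R + sq_norm (fun w => Y w - Z w)%R).
Proof.
move=> mX mY mZ; have mB (U V : T -> R) : measurable_fun setT U ->
    measurable_fun setT V -> measurable_fun setT (fun w => ((U w - V w) ^+ 2)%:E).
  by move=> mU mV; apply: measurable_sqr; exact: measurable_funB.
have mXZ := mB _ _ mX mZ; have mXY := mB _ _ mX mY; have mYZ := mB _ _ mY mZ.
rewrite /sq_norm -ge0_integralD//; try by move=> w _; rewrite lee_fin sqr_ge0.
rewrite -ge0_integralZl//; first last.
- by move=> w _; rewrite adde_ge0// lee_fin sqr_ge0.
- exact: emeasurable_funD.
apply: ge0_le_integral => //.
- by move=> w _; rewrite lee_fin sqr_ge0.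
- by apply: emeasurable_funM => //; exact: emeasurable_funD.
move=> w _; rewrite -EFinD -EFinM lee_fin.
have := sqr_ge0 ((X w - Y w) - (Y w - Z w)); nra.
Qed.

Lemma sq_norm_eq (X Y : T -> R) : X =1 Y -> sq_norm X = sq_norm Y.
Proof. by move=> /funext ->. Qed.

Lemma sq_normC (X Y : T -> R) :
  sq_norm (fun w => X w - Y w)%R = sq_norm (fun w => Y w - X w)%R.
Proof. by apply: eq_integral => w _; rewrite -sqrrN opprB. Qed.

End sq_distance.

Lemma cvge0_le2 (R : realType) (u v : nat -> \bar R) (e : R) : 0 < e ->
  (u @ \oo --> 0)%E -> (v @ \oo --> 0)%E ->
  exists m, (u m <= e%:E)%E /\ (v m <= e%:E)%E.
Proof.
move=> e0 u0 v0.
have near_le (x : nat -> \bar R) : (x @ \oo --> 0)%E ->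
    \forall m \near \oo, (x m <= e%:E)%E.
  move=> /(_ _ (@nbhs_open_ereal_lt R 0 (fun=> e) e0)) xe.
  by near=> m; apply/ltW; near: m; exact: xe.
have [m _ um] : \forall m \near \oo, (u m <= e%:E)%E /\ (v m <= e%:E)%E.
  by near=> m; split; near: m; exact: near_le.
by exists m; exact: um m (leqnn m).
Unshelve. all: by end_near. Qed.

Lemma std_variance_ge0 (R : realType) : 0 <= std_variance :> R.
Proof.
by apply: fine_ge0; apply: integral_ge0 => x _; rewrite lee_fin sqr_ge0.
Qed.

(** * Step processes, their integrals and Riemann sums *)

Section elementary.
Local Open Scope ereal_scope.
Context d (T : measurableType d) (R : realType) (P : probability T R).
Variables (F : R -> set (set T)) (W : R -> {RV P >-> R}).
Hypothesis bW : brownian_wrt F W.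

Notation lam := (@lebesgue_measure R).
Notation RT := (measurableTypeR R * T)%type.

(* sum_(i < el_size) el_coef i 1_]el_left i, el_right i] with intervals that may
   overlap, so that differences need no common refinement *)
Record elementary := Elementary {
  el_size : nat ;
  el_coef : nat -> T -> R ;
  el_left : nat -> R ;
  el_right : nat -> R }.

Definition el_val (S : elementary) (p : RT) : R :=
  (\sum_(i < el_size S)
    el_coef S i p.2 * \1_(`]el_left S i, el_right S i]) p.1)%R.

Definition el_int (S : elementary) (w : T) : R :=
  (\sum_(i < el_size S)
    el_coef S i w * incr W (el_left S i) (el_right S i) w)%R.

Definition el_adapted (a b : R) (S : elementary) : Prop :=
  forall i, (i < el_size S)%N ->
    [/\ (a <= el_left S i)%R, (el_left S i <= el_right S i <= b)%R,
        measurable_wrt (F (el_left S i)) (el_coef S i) &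
        sq_integrable P (el_coef S i)].

Definition el_sub (S D : elementary) : elementary :=
  let n := el_size S in
  let cat A (f g : nat -> A) i := if (i < n)%N then f i else g (i - n)%N in
  Elementary (n + el_size D) (cat _ (el_coef S) (fun i w => - el_coef D i w)%R)
    (cat _ (el_left S) (el_left D)) (cat _ (el_right S) (el_right D)).

Lemma el_val_sub S D p : (el_val (el_sub S D) p = el_val S p - el_val D p)%R.
Proof.
rewrite /el_val big_split_ord/= -sumrN; congr (_ + _)%R.
  by apply: eq_bigr => i _; rewrite ltn_ord.
by apply: eq_bigr => i _; rewrite ltnNge leq_addr/= addKn mulNr.
Qed.

Lemma el_int_sub S D w : (el_int (el_sub S D) w = el_int S w - el_int D w)%R.
Proof.
rewrite /el_int big_split_ord/= -sumrN; congr (_ + _)%R.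
  by apply: eq_bigr => i _; rewrite ltn_ord.
by apply: eq_bigr => i _; rewrite ltnNge leq_addr/= addKn mulNr.
Qed.

Lemma el_adapted_sub a b S D :
  el_adapted a b S -> el_adapted a b D -> el_adapted a b (el_sub S D).
Proof.
move=> Sok Dok i /=; case: ifP => [/Sok//|/negbT]; rewrite -leqNgt => ni inm.
have iD : (i - el_size S < el_size D)%N by rewrite ltn_subLR.
have [ai ib Fi sqi] := Dok _ iD; split=> //.
  exact: measurable_wrt_comp (@oppr_measurable R setT) Fi.
have := sq_integrableZ (-1)%R sqi.
by under eq_fun do rewrite mulN1r.
Qed.

Lemma measurable_el_val a b S : el_adapted a b S -> measurable_fun setT (el_val S).
Proof.
move=> Sok; apply: measurable_sum => i; have [_ _ _ [mX _]] := Sok i (ltn_ord i).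
apply: measurable_funM; first exact: measurableT_comp mX measurable_snd.
by apply: (measurableT_comp
  (f := \1_(`]el_left S i, el_right S i]) : measurableTypeR R -> R)).
Qed.

Lemma measurable_el_int a b S : el_adapted a b S -> measurable_fun setT (el_int S).
Proof.
move=> Sok; apply: measurable_sum => i; have [_ _ _ [mX _]] := Sok i (ltn_ord i).
by apply: measurable_funM => //; exact: measurable_incr.
Qed.

Lemma el_val0 a b S p : el_adapted a b S -> p.1 \notin `[a, b] -> el_val S p = 0%R.
Proof.
move=> Sok pab; rewrite /el_val big1// => i _.
have [al /andP[_ rb] _ _] := Sok i (ltn_ord i).
rewrite indicE memNset ?mulr0//= in_itv/= => /andP[lp pr].
move/negP: pab; apply; rewrite in_itv/=; apply/andP; split.
  by rewrite (le_trans al)// ltW.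
exact: le_trans rb.
Qed.

Lemma el_isometry (a b : R) S : (0 <= a)%R -> el_adapted a b S ->
  sq_norm P (el_int S) = std_variance%:E * sq_norm (lam \x P) (el_val S).
Proof.
move=> a0 Sok; rewrite /sq_norm [in RHS]fubini_tonelli2; last 2 first.
- exact: measurable_sqr (measurable_el_val Sok).
- by move=> p; rewrite lee_fin sqr_ge0.
rewrite (ito_isometry bW)// => i iS; have [ai /andP[-> _] Fi sqi] := Sok i iS.
by split=> //; rewrite (le_trans a0).
Qed.

Lemma el_int_dist (a b : R) S D : (0 <= a)%R -> el_adapted a b S -> el_adapted a b D ->
  sq_norm P (fun w => el_int S w - el_int D w)%R =
  std_variance%:E * sq_norm (lam \x P) (fun p => el_val S p - el_val D p)%R.
Proof.
move=> a0 Sok Dok; rewrite -(sq_norm_eq _ (el_int_sub S D)).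
by rewrite -(sq_norm_eq _ (el_val_sub S D)) (el_isometry a0 (el_adapted_sub Sok Dok)).
Qed.

Definition el_of_simple a b (S : simple_process P F a b) : elementary :=
  Elementary (sp_size S) (fun i w => sp_coef S i w) (sp_time S)
    (fun i => sp_time S i.+1).

Lemma el_of_simple_adapted a b (S : simple_process P F a b) :
  el_adapted a b (el_of_simple S).
Proof.
have nd j i : (i <= j)%N -> (j <= sp_size S)%N -> (sp_time S i <= sp_time S j)%R.
  elim: j => [|j IH]; first by rewrite leqn0 => /eqP ->.
  rewrite leq_eqVlt => /predU1P[->//|ij] js.
  by rewrite (le_trans (IH ij (ltnW js)))// sp_time_le.
move=> i iS /=; split.
- by apply: le_trans (nd i 0%N _ _); rewrite ?sp_time_first// ltnW.
- rewrite sp_time_le//=; apply: le_trans (nd (sp_size S) i.+1 iS (leqnn _)) _.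
  by rewrite sp_time_last.
- move=> B mB; apply: sub_sigma_algebra; apply: (sp_coef_adapted iS).
  by exists B => //; rewrite setTI.
- by split=> //; have := sp_coef_L2 iS; rewrite unlock.
Qed.

(** [H] is measurable on the strip over [a, b] only. Extension by zero puts it on the whole product
    space, and adapted step processes vanish off the strip as well. *)
Definition restrict_time (a b : R) (H : R -> T -> R) : RT -> R :=
  (fun p : RT => H p.1 p.2) \_ (`[a, b] `*` setT).

Lemma measurable_restrict_time (a b : R) (H : R -> T -> R) :
  measurable_fun (`[a, b] `*` [set: T]) (fun x : R * T => H x.1 x.2) ->
  measurable_fun setT (restrict_time a b H).
Proof.
by move=> mH; apply/(measurable_restrictT _ _).1 => //; exact: measurableX.
Qed.

Lemma sq_norm_restrict_time (a b : R) (H : R -> T -> R) E :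
  measurable_fun (`[a, b] `*` [set: T]) (fun x : R * T => H x.1 x.2) ->
  el_adapted a b E ->
  sq_norm (lam \x P) (fun p => restrict_time a b H p - el_val E p)%R =
  \int[P]_w \int[lam]_(s in `[a, b]) ((H s w - el_val E (s, w)) ^+ 2)%:E.
Proof.
move=> mH Eok; rewrite /sq_norm fubini_tonelli2; last 2 first.
- apply: measurable_sqr; apply: measurable_funB.
    exact: measurable_restrict_time.
  exact: measurable_el_val Eok.
- by move=> p; rewrite lee_fin sqr_ge0.
apply: eq_integral => w _; rewrite [RHS]integral_mkcond; apply: eq_integral => s _.
rewrite /restrict_time !patchE/=; case: ifPn => sab.
  by rewrite ifT//; move: sab; rewrite !inE => -[].
rewrite ifF; last by apply/negbTE; apply: contra sab; rewrite !inE.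
rewrite (el_val0 Eok) ?subr0 ?expr0n//=.
by apply: contra sab => sab; rewrite inE.
Qed.

(** Some simple process E has both its values close to [H] and its integral close to [I]; the
    isometry compares E with [D], so any step process near [H] computes [I] approximately. *)
Lemma ito_integral_dist (a b : R) (H : R -> T -> R) (I : {RV P >-> R}) D (c : R) :
  (0 <= a)%R -> is_ito_integral F W a b H I -> el_adapted a b D ->
  \int[P]_w \int[lam]_(s in `[a, b]) ((H s w - el_val D (s, w)) ^+ 2)%:E <= c%:E ->
  sq_norm P (fun w => I w - el_int D w)%R <= (4 * std_variance * c)%:E.
Proof.
move=> a0 [mH [S [SH SI]]] Dok Dc.
pose H' := restrict_time a b H.
have mH' : measurable_fun setT H' by exact: measurable_restrict_time.
have HE E (Eok : el_adapted a b E) := sq_norm_restrict_time mH Eok.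
rewrite -HE// in Dc.
have k0 := std_variance_ge0 R.
apply/lee_addgt0Pr => e e0.
(* With V the variance constant, two triangle inequalities give 2 (e' + V 2 (e' + c)) = e' (2 + 4 V)
   + 4 V c. *)
pose e' := (e / (2 + 4 * std_variance))%R.
have e'0 : (0 < e')%R by rewrite divr_gt0// ltr_wpDr// mulr_ge0.
have [m [SHm SIm]] := cvge0_le2 e'0 SH SI.
pose E := el_of_simple (S m).
have Sok : el_adapted a b E by exact: el_of_simple_adapted.
have SHm' : sq_norm (lam \x P) (fun p => H' p - el_val E p)%R <= e'%:E by rewrite HE.
have SIm' : sq_norm P (fun w => I w - el_int E w)%R <= e'%:E.
  by move: SIm; rewrite unlock.
have mI : measurable_fun setT I by [].
have mE := measurable_el_int Sok; have mD := measurable_el_int Dok.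
have mvE := measurable_el_val Sok; have mvD := measurable_el_val Dok.
apply: (le_trans (@sq_norm_triangle _ _ _ P _ _ _ mI mE mD)).
rewrite (el_int_dist a0 Sok Dok).
rewrite sq_normC in SHm'.
have := @sq_norm_triangle _ _ _ (lam \x P) _ _ _ mvE mH' mvD.
move=> /le_trans /(_ (lee_wpmul2l _ (leeD SHm' Dc))).
rewrite lee_fin => /(_ (ler0n _ _)); rewrite -EFinD -EFinM => ED.
have {ED} := lee_wpmul2l (_ : 0 <= std_variance%:E) ED.
rewrite lee_fin -EFinM => /(_ k0) ED.
apply: (le_trans (lee_wpmul2l _ (leeD SIm' ED))); first by rewrite lee_fin ler0n.
rewrite -!EFinD -EFinM lee_fin.
have -> : e = (e' * (2 + 4 * std_variance))%R.
  by rewrite divfK// gt_eqF// ltr_wpDr// mulr_ge0.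
by rewrite le_eqVlt; apply/orP; left; apply/eqP; ring.
Qed.

Lemma measurable_wrt_cst (G : set (set T)) (c : R) : measurable_wrt G (cst c).
Proof. by apply/measurable_wrtP; exact: measurable_cst. Qed.

Lemma sq_integrable_incr (r s : R) : (0 <= r <= s)%R ->
  sq_integrable P (incr W r s).
Proof.
move=> rs.
have := sq_integrable_mul_incr bW rs (@measurable_wrt_cst _ 1%R) (sq_integrable_cst1 P).
by under eq_fun do rewrite mul1r.
Qed.

Lemma sq_norm_incr (r s : R) : (0 <= r <= s)%R ->
  sq_norm P (incr W r s) = (std_variance * (s - r))%:E.
Proof.
move=> rs; have H1 : has_integral P (cst 1%R) 1%R.
  split; first exact: sq_integrable_integrable (sq_integrable_cst1 P).
  rewrite -[LHS]/(\int[P]_w cst 1 w) integral_cst// mul1e.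
  exact: probability_setT.
have [_] := has_integral_incr_sqr bW rs (@measurable_wrt_cst _ 1%R) H1.
by rewrite mul1r => <-; apply: eq_integral => w _; rewrite mul1r.
Qed.

(** The step process with value 1 on ]a, s] is at distance 0 from the integrand 1, so the preceding
    estimate applies with c = 0. *)
Lemma ito_integral1 (a s : R) (J : {RV P >-> R}) : (0 <= a <= s)%R ->
  is_ito_integral F W a s (fun _ _ => 1%R) J ->
  sq_norm P (fun w => J w - incr W a s w)%R = 0.
Proof.
move=> /andP[a0 als] itoJ.
pose D := Elementary 1 (fun _ => cst 1%R) (fun=> a) (fun=> s).
have Dok : el_adapted a s D.
  move=> i _ /=; split; rewrite ?als ?lexx//; first exact: measurable_wrt_cst.
  exact: sq_integrable_cst1.
have Dint w : el_int D w = incr W a s w by rewrite /el_int big_ord1 mul1r.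
apply/eqP; rewrite eq_le sq_norm_ge0 andbT.
rewrite -[X in _ <= X%:E](mulr0 (4 * std_variance)%R).
rewrite (_ : (fun w => _) = fun w => J w - el_int D w)%R; last first.
  by apply/funext => w; rewrite Dint.
apply: (ito_integral_dist a0 itoJ Dok).
rewrite (eq_integral (cst 0)) ?integral0// => w _.
(* The steps are open on the left, so the two integrands differ at the point a, which is a null
   set. *)
transitivity (\int[lam]_(x in `[a, s]) (\1_([set a] : set R) x)%:E); last first.
  rewrite integral_indic//.
  rewrite (_ : _ `&` _ = [set a]); first exact: lebesgue_measure_set1.
  by apply: setIidl => _ ->; rewrite /= in_itv/= lexx.
apply: eq_integral => x; rewrite inE/= in_itv/= => /andP[ax xs].
rewrite /el_val big_ord1/= mul1r !indicE/=.
move: ax; rewrite le_eqVlt => /predU1P[<-|ax].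
  rewrite [_ \in [set a]]mem_set// memNset/= ?subr0 ?expr1n//.
  by rewrite in_itv/= ltxx.
rewrite [_ \in [set a]]memNset/=; last by move=> xa; rewrite xa ltxx in ax.
by rewrite mem_set/= ?subrr ?expr0n//= in_itv/= ax.
Qed.

Definition riemann_time (a : R) (N i : nat) : R := (a + i%:R / N%:R)%R.

(** Left-point discretisation of the inner integral W_s - W_a; its integral against the other
    process discretises the iterated integral. *)
Definition riemann (a : R) (N : nat) : elementary :=
  Elementary N (fun i => incr W a (riemann_time a N i)) (riemann_time a N)
    (fun i => riemann_time a N i.+1).

Lemma riemann_time_le (a : R) (N i j : nat) : (i <= j)%N ->
  (riemann_time a N i <= riemann_time a N j)%R.
Proof. by move=> ij; rewrite lerD2l ler_wpM2r ?invr_ge0// ler_nat. Qed.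

Lemma riemann_time0 (a : R) (N : nat) : riemann_time a N 0 = a.
Proof. by rewrite /riemann_time mul0r addr0. Qed.

Lemma riemann_timeN (a : R) (N : nat) : (0 < N)%N ->
  riemann_time a N N = (a + 1)%R.
Proof. by move=> N0; rewrite /riemann_time divff// pnatr_eq0 -lt0n. Qed.

Lemma riemann_timeS (a : R) (N i : nat) :
  riemann_time a N i.+1 = (riemann_time a N i + N%:R^-1)%R.
Proof. by rewrite /riemann_time -natr1 mulrDl mul1r addrA. Qed.

Lemma riemann_time_ge (a : R) (N i : nat) : (a <= riemann_time a N i)%R.
Proof. by rewrite -[leLHS](riemann_time0 a N) riemann_time_le. Qed.

Lemma riemann_val (a s : R) (N : nat) : (0 < N)%N -> s \in `[a, a + 1]%R ->
  exists r, [/\ (a <= r <= s)%R, (s - r <= N%:R^-1)%R &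
    forall w, el_val (riemann a N) (s, w) = incr W a r w].
Proof.
move=> N0; rewrite in_itv/= le_eqVlt => /andP[/predU1P[<- _|als sa]].
  (* The left end a lies in no step ]t_i, t_(i+1)]; the value there is 0 = W_a - W_a. *)
  exists a; split; rewrite ?lexx ?subrr ?invr_ge0// => w.
  rewrite /incr subrr /el_val big1// => i _; rewrite indicE memNset ?mulr0//=.
  by rewrite in_itv/= ltNge riemann_time_ge.
have ex : exists i, (s <= riemann_time a N i.+1)%R.
  by exists N.-1; rewrite prednK// riemann_timeN.
(* Minimality of i gives t_i < s, so s lies in the step ]t_i, t_(i+1)] and in no other. *)
have [i si imin] := ex_minnP ex.
have iN : (i < N)%N.
  by rewrite -[N]prednK// ltnS; apply: imin; rewrite prednK// riemann_timeN.
have ti : (riemann_time a N i < s)%R.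
  case: i imin {si iN} => [_|i imin]; first by rewrite riemann_time0.
  by rewrite ltNge; apply/negP => /imin; rewrite ltnn.
exists (riemann_time a N i); split.
- by rewrite riemann_time_ge ltW.
- by rewrite lerBlDl -riemann_timeS.
move=> w; rewrite /el_val (bigD1 (Ordinal iN))//= big1 ?addr0.
  by rewrite indicE mem_set ?mulr1//= in_itv/= ti.
move=> j /eqP ji; rewrite indicE memNset ?mulr0//= in_itv/= => /andP[js sj].
case: (ltngtP j i) => [ji'|ij|eqij].
- by have := imin _ sj; rewrite leqNgt ji'.
- by have := riemann_time_le a N ij; rewrite leNgt (lt_le_trans js si).
- by apply: ji; exact: val_inj.
Qed.

Lemma riemann_adapted (a : R) (N : nat) : (0 < N)%N -> (0 <= a)%R ->
  el_adapted a (a + 1) (riemann a N).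
Proof.
move=> N0 a0 i iN /=; have at_ := riemann_time_ge a N i; split=> //.
- by rewrite riemann_time_le//= -(riemann_timeN a N0) riemann_time_le.
- by apply: (adapted_incr bW); rewrite ?a0 ?at_ ?lexx ?(le_trans a0 at_).
- by apply: sq_integrable_incr; rewrite a0.
Qed.

(** For each fixed s, J_s equals W_s - W_a off a null set that depends on s, so Tonelli first moves
    the integral over w inside. There the error is W_s - W_r with s - r <= 1 / N, and the factor 2
    comes from the triangle inequality. *)
Lemma riemann_dist (a : R) (N : nat) (J : R -> {RV P >-> R}) : (0 < N)%N ->
  (0 <= a)%R ->
  measurable_fun (`[a, (a + 1)%R] `*` [set: T]) (fun x : R * T => J x.1 x.2) ->
  (forall s, s \in `[a, a + 1]%R -> is_ito_integral F W a s (fun _ _ => 1%R) (J s)) ->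
  \int[P]_w \int[lam]_(s in `[a, (a + 1)%R])
    ((J s w - el_val (riemann a N) (s, w)) ^+ 2)%:E <=
  (2 * std_variance / N%:R)%:E.
Proof.
move=> N0 a0 mJ itoJ; have Dok := riemann_adapted N0 a0.
rewrite -(@sq_norm_restrict_time a (a + 1) (fun s w => J s w) _ mJ Dok).
set K := (fun p => _); have mK : measurable_fun setT K.
  apply: measurable_funB; first exact: measurable_restrict_time.
  exact: measurable_el_val Dok.
rewrite /sq_norm fubini_tonelli1; last 2 first.
- exact: measurable_sqr.
- by move=> p; rewrite lee_fin sqr_ge0.
set c := (2 * std_variance / N%:R)%R.
have c0 : (0 <= c)%R by rewrite divr_ge0// mulr_ge0// std_variance_ge0.
apply: (@le_trans _ _ (\int[lam]_s (c * \1_(`[a, (a + 1)%R]) s)%:E)); last first.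
  under eq_integral do rewrite EFinM.
  have mI : measurable_fun [set: measurableTypeR R]
      (fun s => (\1_(`[a, (a + 1)%R]) s : R)%:E).
    exact/measurable_EFinP/measurable_indic.
  rewrite ge0_integralZl//.
  rewrite integral_indic// setIT.
  rewrite [X in _ * X](_ : _ = 1) ?mule1//.
  rewrite [LHS]lebesgue_measure_itv/= lte_fin ltrDl ltr01 -EFinB.
  by rewrite addrAC subrr add0r.
apply: ge0_le_integral => //.
- by move=> s _; apply: integral_ge0 => w _; rewrite lee_fin sqr_ge0.
- apply: (measurable_fun_fubini_tonelli_F (fun p => (K p ^+ 2)%:E)).
    exact: measurable_sqr.
  by move=> p; rewrite lee_fin sqr_ge0.
- by apply/measurable_EFinP; apply: measurable_funM.
move=> s _; rewrite /fubini_F.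
have [sab|sab] := boolP (s \in `[a, (a + 1)%R]); last first.
  rewrite integral0_eq => [|w _]; first by rewrite lee_fin (mulr_ge0 c0).
  rewrite /K /restrict_time patchE ifF; last first.
    by apply/negbTE; apply: contra sab; rewrite inE => -[].
  by rewrite (el_val0 Dok)//= subr0 expr0n.
rewrite indicE mem_set//= mulr1.
have [r [/andP[ar rs] srN Dr]] := riemann_val N0 sab.
have r0 := le_trans a0 ar; have s0 := le_trans r0 rs.
have -> : \int[P]_w (K (s, w) ^+ 2)%:E = sq_norm P (fun w => J s w - incr W a r w)%R.
  apply: eq_integral => w _; rewrite /K /restrict_time patchE ifT ?Dr//.
  by rewrite inE.
have mJs : measurable_fun setT (J s) by [].
apply: (le_trans (@sq_norm_triangle _ _ _ P _ _ _ mJs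
  (measurable_incr W a s) (measurable_incr W a r))).
have as_ : (0 <= a <= s)%R by rewrite a0 (le_trans ar).
rewrite (ito_integral1 as_ (itoJ _ sab)) add0e.
rewrite (_ : (fun w => _) = incr W r s); last first.
  by apply/funext => w; rewrite /incr; ring.
rewrite sq_norm_incr ?r0// -EFinM lee_fin /c -mulrA.
by rewrite ler_wpM2l// ler_wpM2l// std_variance_ge0.
Qed.

End elementary.

(** * Rotation invariance of the area sums *)

Section joint_brownian.
Local Open Scope ereal_scope.
Context d (T : measurableType d) (R : realType) (P : probability T R).
Variables W1 W2 : R -> {RV P >-> R}.

Lemma joint_wrt1 (r u1 u2 : R) : (0 <= r <= u1)%R ->
  measurable_wrt (joint_events W1 W2 u1 u2) (W1 r).
Proof.
move=> ru B mB; apply: sub_sigma_algebra; left.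
by apply: process_events_wrt mB; rewrite /= in_itv/=.
Qed.

Lemma joint_wrt2 (r u1 u2 : R) : (0 <= r <= u2)%R ->
  measurable_wrt (joint_events W1 W2 u1 u2) (W2 r).
Proof.
move=> ru B mB; apply: sub_sigma_algebra; right.
by apply: process_events_wrt mB; rewrite /= in_itv/=.
Qed.

Lemma joint_events_sub (u1 u2 v1 v2 : R) : (u1 <= v1)%R -> (u2 <= v2)%R ->
  joint_events W1 W2 u1 u2 `<=` joint_events W1 W2 v1 v2.
Proof.
have sub (u v : R) : (u <= v)%R -> `[0%R, u] `<=` `[0%R, v].
  move=> uv x /=; rewrite !in_itv/= => /andP[-> xu]; exact: le_trans uv.
by move=> uv1 uv2 A [] /process_events_sub WA; [left|right]; apply: WA; exact: sub.
Qed.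

Lemma brownian_joint :
  standard_wiener W2 -> independent_processes W1 W2 ->
  brownian_wrt (joint_filtration W1 W2) W2.
Proof.
move=> w2 indep; split.
- move=> s; apply: smallest_sub (@joint_events_measurable _ _ _ _ _ _ s s).
  exact: sigma_algebra_measurable.
- move=> s t st; apply: sub_sigma_algebra2; exact: joint_events_sub.
- move=> s s0 B mB; apply: sub_sigma_algebra; apply: joint_wrt2 => //.
  by rewrite s0 lexx.
- move=> s t s0 st A B; rewrite sigma_algebra_id; last exact: smallest_sigma_algebra.
  exact: joint_events_indep.
Qed.

End joint_brownian.

Lemma joint_eventsC d (T : measurableType d) (R : realType)
  (P : probability T R) (W1 W2 : R -> {RV P >-> R}) u1 u2 :
  joint_events W1 W2 u1 u2 = joint_events W2 W1 u2 u1.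
Proof. exact: setUC. Qed.

Lemma joint_filtrationC d (T : measurableType d) (R : realType)
  (P : probability T R) (W1 W2 : R -> {RV P >-> R}) :
  joint_filtration W1 W2 = joint_filtration W2 W1.
Proof. by apply/funext => s; rewrite /joint_filtration setUC. Qed.

Section area.
Local Open Scope ereal_scope.
Context d (T : measurableType d) (R : realType) (P : probability T R).
Variables W1 W2 : R -> {RV P >-> R}.
Hypotheses (w1 : standard_wiener W1) (w2 : standard_wiener W2).
Hypothesis indep : independent_processes W1 W2.

Let bW2 : brownian_wrt (joint_filtration W1 W2) W2 := brownian_joint w2 indep.
Let bW1 : brownian_wrt (joint_filtration W1 W2) W1.
Proof.
by rewrite joint_filtrationC; exact: brownian_joint w1 (independent_processesC indep).
Qed.

Definition area_sum (a : R) (N : nat) (w : T) : R :=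
  (el_int W2 (riemann W1 a N) w - el_int W1 (riemann W2 a N) w)%R.

Lemma measurable_area_sum (a : R) (N : nat) : (0 < N)%N -> (0 <= a)%R ->
  measurable_fun setT (area_sum a N).
Proof.
move=> N0 a0; apply: measurable_funB.
  exact: measurable_el_int (riemann_adapted bW1 N0 a0).
exact: measurable_el_int (riemann_adapted bW2 N0 a0).
Qed.

(** The error 2 v / N of the inner discretisation, with v the variance constant, is multiplied by 4
    v in passing to the outer integral. The difference of two such integrals then costs 2 (8 + 8) =
    32 below. *)
Let iterated_dist (F : R -> set (set T)) (V W : R -> {RV P >-> R}) (a : R)
    (N : nat) (I : {RV P >-> R}) : brownian_wrt F V -> brownian_wrt F W ->
  (0 < N)%N -> (0 <= a)%R -> is_iterated_ito_integral F V W a (a + 1) I ->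
  sq_norm P (fun w => I w - el_int W (riemann V a N) w)%R <=
  (8 * std_variance ^+ 2 / N%:R)%:E.
Proof.
move=> bV bW N0 a0 [J [itoJ itoI]].
have [mJ _] := itoI.
have Dok := riemann_adapted bV N0 a0.
have H := riemann_dist bV N0 a0 mJ itoJ.
apply: (le_trans (ito_integral_dist bW a0 itoI Dok H)).
by rewrite lee_fin le_eqVlt; apply/orP; left; apply/eqP; ring.
Qed.

Lemma area_sum_dist (a : R) (N : nat) (A : {RV P >-> R}) : (0 < N)%N ->
  (0 <= a)%R -> is_area_integral W1 W2 a (a + 1) A ->
  sq_norm P (fun w => A w - area_sum a N w)%R <=
  (32 * std_variance ^+ 2 / N%:R)%:E.
Proof.
move=> N0 a0 [I12 [I21 [it12 it21 AE]]].
have d12 := iterated_dist bW1 bW2 N0 a0 it12.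
have d21 := iterated_dist bW2 bW1 N0 a0 it21.
set X := (fun w => I12 w - _)%R in d12; set Y := (fun w => I21 w - _)%R in d21.
have mX : measurable_fun setT X.
  by apply: measurable_funB => //; exact: measurable_el_int (riemann_adapted bW1 N0 a0).
have mY : measurable_fun setT Y.
  by apply: measurable_funB => //; exact: measurable_el_int (riemann_adapted bW2 N0 a0).
have mQ := measurable_area_sum N0 a0.
have -> : sq_norm P (fun w => A w - area_sum a N w)%R = sq_norm P (fun w => X w - Y w)%R.
  apply: ae_eq_integral => //.
  - by apply: measurable_sqr; exact: measurable_funB.
  - by apply: measurable_sqr; exact: measurable_funB.
  apply: filterS AE => w /= -> _; congr EFin; congr (_ ^+ 2)%R.
  by rewrite /area_sum /X /Y; ring.
have m0 : measurable_fun [set: T] (fun=> 0%R : R) by exact: measurable_cst.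
apply: (le_trans (@sq_norm_triangle _ _ _ P _ _ _ mX m0 mY)).
have -> : sq_norm P (fun w => X w - 0)%R = sq_norm P X.
  by apply: sq_norm_eq => w; rewrite subr0.
have -> : sq_norm P (fun w => 0 - Y w)%R = sq_norm P Y.
  by rewrite sq_normC; apply: sq_norm_eq => w; rewrite subr0.
apply: (le_trans (lee_wpmul2l _ (leeD d12 d21))); first by rewrite lee_fin.
by rewrite -EFinD -EFinM lee_fin le_eqVlt; apply/orP; left; apply/eqP; ring.
Qed.

(* state (x, y, q): the two increments accumulated so far and the area sum *)
Definition state (a : R) (N i : nat) (w : T) : (R * R) * R :=
  let t := riemann_time a N in
  ((incr W1 a (t i) w, incr W2 a (t i) w),
   \sum_(j < i) (incr W1 a (t j) w * incr W2 (t j) (t j.+1) w -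
                 incr W2 a (t j) w * incr W1 (t j) (t j.+1) w))%R.

Definition step (z : (R * R) * R) (p : R * R) : (R * R) * R :=
  ((z.1.1 + p.1, z.1.2 + p.2), z.2 + (z.1.1 * p.2 - z.1.2 * p.1))%R.

Definition rotation3 (c s : R) (z : (R * R) * R) : (R * R) * R :=
  (rotation c s z.1, z.2).

(** The area grows by the determinant of z.1 and p, which the rotation multiplies by its own
    determinant c^2 + s^2 = 1. *)
Lemma rotation3_step (c s : R) z p : (c ^+ 2 + s ^+ 2 = 1)%R ->
  rotation3 c s (step z p) = step (rotation3 c s z) (rotation c s p).
Proof.
move=> cs; rewrite /rotation3 /step /rotation/=; congr (_, _, _); try by ring.
rewrite -[in LHS](mul1r (_ - _)%R) -cs; ring.
Qed.

Lemma stateS a N i w : state a N i.+1 w =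
  step (state a N i w) (incr W1 (riemann_time a N i) (riemann_time a N i.+1) w,
                        incr W2 (riemann_time a N i) (riemann_time a N i.+1) w).
Proof.
rewrite /state /step /= big_ord_recr/=; congr (_, _, _);
by rewrite /incr; ring.
Qed.

Lemma measurable_step d' (S : measurableType d') (z : S -> (R * R) * R)
    (p : S -> R * R) : measurable_fun setT z -> measurable_fun setT p ->
  measurable_fun setT (fun x => step (z x) (p x)).
Proof.
move=> mz mp.
have mz1 : measurable_fun setT (fun x => (z x).1) by exact: measurableT_comp mz.
have mz2 : measurable_fun setT (fun x => (z x).2) by exact: measurableT_comp mz.
have mz11 : measurable_fun setT (fun x => (z x).1.1) by exact: measurableT_comp mz1.
have mz12 : measurable_fun setT (fun x => (z x).1.2) by exact: measurableT_comp mz1.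
have mp1 : measurable_fun setT (fun x => (p x).1) by exact: measurableT_comp mp.
have mp2 : measurable_fun setT (fun x => (p x).2) by exact: measurableT_comp mp.
apply: measurable_fun_pair.
  by apply: measurable_fun_pair; exact: measurable_funD.
by apply: measurable_funD => //; apply: measurable_funB; exact: measurable_funM.
Qed.

Lemma measurable_rotation3 c s : measurable_fun setT (rotation3 c s).
Proof.
apply: measurable_fun_pair => //.
by apply: measurableT_comp => //; exact: measurable_rotation.
Qed.

Lemma state_wrt a N i : (0 <= a)%R ->
  let t := riemann_time a N i in
  measurable_wrt (joint_events W1 W2 t t) (state a N i).
Proof.
move=> a0; elim: i => [|i IH] /=.
  have -> : state a N 0 = cst (0, 0, 0)%R.
    apply/funext => w; rewrite /state big_ord0 /incr riemann_time0.
    by rewrite !subrr.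
  by apply/measurable_wrtP; exact: measurable_cst.
have -> : state a N i.+1 = fun w => step (state a N i w)
    (incr W1 (riemann_time a N i) (riemann_time a N i.+1) w,
     incr W2 (riemann_time a N i) (riemann_time a N i.+1) w).
  by apply/funext => w; rewrite stateS.
set t := riemann_time a N i; set t' := riemann_time a N i.+1.
have t0 : (0 <= t)%R := le_trans a0 (riemann_time_ge a N i).
have tt' : (t <= t')%R by exact: riemann_time_le.
have t'0 := le_trans t0 tt'.
apply/measurable_wrtP; apply: measurable_step.
  apply/measurable_wrtP; apply: measurable_wrt_mono IH.
  exact: joint_events_sub.
apply: measurable_fun_pair; apply: measurable_funB; apply/measurable_wrtP;
  by [apply: joint_wrt1; rewrite ?t0 ?t'0 ?tt' ?lexx|
      apply: joint_wrt2; rewrite ?t0 ?t'0 ?tt' ?lexx].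
Qed.

Section rotation_invariance.
Variables (a : R) (N : nat).
Hypotheses (a0 : (0 <= a)%R) (N0 : (0 < N)%N).
Notation nu := (@normal_prob R 0 (Num.sqrt N%:R^-1)).

Lemma integral_stateS i (f : (R * R) * R -> \bar R) : measurable_fun setT f ->
  (forall z, 0 <= f z) ->
  \int[P]_w f (state a N i.+1 w) =
  \int[P]_w \int[nu]_x \int[nu]_y f (step (state a N i w) (x, y)).
Proof.
move=> mf f0; set t := riemann_time a N i; set t' := riemann_time a N i.+1.
have t0 : (0 <= t)%R := le_trans a0 (riemann_time_ge a N i).
have tt' : (t < t')%R by rewrite /t' riemann_timeS ltrDl invr_gt0 ltr0n.
have dt : (t' - t = N%:R^-1)%R by rewrite /t' riemann_timeS addrC addKr.
have t'0 : (0 <= t')%R by rewrite (le_trans t0) ?ltW.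
pose Z := state a N i; pose xi := incr W1 t t'; pose eta := incr W2 t t'.
(* The increment of W2 is integrated out first, with that of W1 counted as known up to t'; then that
   of W1, with both processes known up to t. *)
have i2 := joint_events_indep (u1 := t') w2 indep t0 tt'.
have i1 := joint_events_indep (u1 := t) w1 (independent_processesC indep) t0 tt'.
rewrite dt in i1 i2.
have Zt : measurable_wrt (joint_events W1 W2 t t) Z by exact: (@state_wrt a N i a0).
have ZX : measurable_wrt (joint_events W1 W2 t' t) (fun w => (Z w, xi w)).
  apply: measurable_wrt_pair.
    by apply: measurable_wrt_mono Zt; apply: joint_events_sub; rewrite ?lexx// ltW.
  apply/measurable_wrtP; apply: measurable_funB; apply/measurable_wrtP;
  by apply: joint_wrt1; rewrite ?t0 ?t'0 ?lexx ?ltW.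
have Zt' : measurable_wrt (joint_events W2 W1 t t) Z by rewrite joint_eventsC.
pose g (q : (((R * R) * R) * measurableTypeR R) * measurableTypeR R) : \bar R :=
  f (step q.1.1 (q.1.2, q.2)).
have mg : measurable_fun setT g.
  apply: (measurableT_comp mf); apply: measurable_step.
    by apply: measurableT_comp.
  by apply: measurable_fun_pair => //; apply: measurableT_comp.
have g0 q : 0 <= g q by exact: f0.
have := @ge0_integral_indep _ _ _ P _ _ _ (measurableTypeR R) _ _ eta nu
  (@joint_events_measurable _ _ _ _ _ _ _ _) ZX (measurable_incr W2 t t') i2 g mg g0.
have -> : \int[P]_w g (Z w, xi w, eta w) = \int[P]_w f (state a N i.+1 w).
  by apply: eq_integral => w _; rewrite stateS.
move=> ->.
pose h (q : ((R * R) * R) * measurableTypeR R) : \bar R := \int[nu]_y g (q, y).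
have mh : measurable_fun setT h by exact: (measurable_fun_fubini_tonelli_F g).
have h0 q : 0 <= h q by exact: integral_ge0.
exact: (@ge0_integral_indep _ _ _ P _ _ _ (measurableTypeR R) _ _ xi nu
  (@joint_events_measurable _ _ _ _ _ _ _ _) Zt' (measurable_incr W1 t t') i1 h mh h0).
Qed.

(* The rotation commutes with [step] and preserves the law of each pair of
   increments, so its invariance propagates along the chain. *)
Lemma integral_state_rotation (c s : R) i (f : (R * R) * R -> \bar R) :
  (c ^+ 2 + s ^+ 2 = 1)%R -> (0 < 1 + c)%R ->
  measurable_fun setT f -> (forall z, 0 <= f z) ->
  \int[P]_w f (rotation3 c s (state a N i w)) = \int[P]_w f (state a N i w).
Proof.
move=> cs c1; elim: i f => [|i IH] f mf f0.
  apply: eq_integral => w _; congr f.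
  rewrite /state big_ord0 /incr riemann_time0 !subrr /rotation3 /rotation/=.
  by rewrite !mulr0 addr0.
have sig0 : (Num.sqrt N%:R^-1 != 0 :> R)%R.
  by rewrite sqrtr_eq0 -ltNge invr_gt0 ltr0n.
have mfr : measurable_fun setT (f \o rotation3 c s).
  by apply: measurableT_comp => //; exact: measurable_rotation3.
rewrite (@integral_stateS i (f \o rotation3 c s) mfr (fun=> f0 _)).
rewrite (@integral_stateS i f mf f0).
pose g z := \int[nu]_x \int[nu]_y f (step z (x, y)).
have mstep z : measurable_fun setT (fun p => f (step z p)).
  by apply: (measurableT_comp mf); exact: measurable_step.
transitivity (\int[P]_w g (rotation3 c s (state a N i w))).
  apply: eq_integral => w _.
  transitivity (\int[nu]_x \int[nu]_y
      f (step (rotation3 c s (state a N i w)) (rotation c s (x, y)))).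
    by apply: eq_integral => x _; apply: eq_integral => y _; rewrite /= rotation3_step.
  exact: (@ge0_integral_normal_prob_rotation R _ sig0 c s
    (fun p => f (step (rotation3 c s (state a N i w)) p))).
apply: IH.
  pose k (q : (((R * R) * R) * measurableTypeR R) * measurableTypeR R) : \bar R :=
    f (step q.1.1 (q.1.2, q.2)).
  have mk : measurable_fun setT k.
    apply: (measurableT_comp mf); apply: measurable_step.
      by apply: measurableT_comp.
    by apply: measurable_fun_pair => //; apply: measurableT_comp.
  pose h (q : ((R * R) * R) * measurableTypeR R) : \bar R := \int[nu]_y k (q, y).
  have k0 q : 0 <= k q by exact: f0.
  have mh : measurable_fun setT h by exact: (measurable_fun_fubini_tonelli_F k).
  have h0 q : 0 <= h q by exact: integral_ge0.
  exact: (measurable_fun_fubini_tonelli_F h).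
by move=> z; apply: integral_ge0 => x _; exact: integral_ge0.
Qed.

Lemma stateN w : state a N N w =
  ((incr W1 a (a + 1) w, incr W2 a (a + 1) w), area_sum a N w).
Proof.
rewrite /state riemann_timeN//; congr (_, _).
by rewrite /area_sum /el_int /riemann/= -sumrB.
Qed.

End rotation_invariance.

End area.

(** * Moments *)

Section truncated_power.
Context {R : realType}.

(** Truncating |a| before taking the power gives a bounded Lipschitz function; for even p it equals
    a^p as soon as |a| <= M. *)
Definition trunc_power (M : R) (p : nat) (a : R) : R := Num.min `|a| M ^+ p.

Lemma trunc_power_ge0 M p a : 0 <= M -> 0 <= trunc_power M p a.
Proof. by move=> M0; rewrite exprn_ge0// le_min normr_ge0. Qed.

Lemma trunc_power_le M p a : 0 <= M -> trunc_power M p a <= M ^+ p.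
Proof.
move=> M0; rewrite lerXn2r ?nnegrE//; first by rewrite le_min normr_ge0.
by rewrite ge_min lexx orbT.
Qed.

Lemma trunc_power_nd M N p a : 0 <= M -> M <= N ->
  trunc_power M p a <= trunc_power N p a.
Proof.
move=> M0 MN; have N0 := le_trans M0 MN.
rewrite lerXn2r ?nnegrE ?le_min ?normr_ge0//.
by rewrite ge_min lexx/= ge_min MN orbT.
Qed.

Lemma trunc_power_id M k a : `|a| <= M -> trunc_power M (2 * k) a = a ^+ (2 * k).
Proof. by move=> aM; rewrite /trunc_power min_l// !exprM real_normK// num_real. Qed.

Lemma measurable_trunc_power M p : measurable_fun setT (trunc_power M p).
Proof.
by apply: measurable_funX; apply: measurable_minr => //; exact: measurableT_comp.
Qed.

(** Induction on p by the product rule: the truncation of |a| is 1-Lipschitz and at most M, and its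
    p-th power is at most M^p, whence the constant M L + M^p. *)
Lemma trunc_power_lipschitz M p : 0 <= M ->
  exists2 L, 0 <= L & forall a b,
    `|trunc_power M p a - trunc_power M p b| <= L * `|a - b|.
Proof.
move=> M0; elim: p => [|p [L L0 HL]].
  by exists 0 => // a b; rewrite /trunc_power !expr0 subrr normr0 mul0r.
exists (M * L + M ^+ p) => [|a b]; first by rewrite addr_ge0 ?mulr_ge0 ?exprn_ge0.
have minM c : `|Num.min `|c| M| <= M.
  by rewrite ger0_norm ?le_min ?normr_ge0// ge_min lexx orbT.
have min1 : `|Num.min `|a| M - Num.min `|b| M| <= `|a - b|.
  have := lerB_dist a b; have := lerB_dist b a; rewrite (distrC b a).
  by rewrite ler_norml; case: (leP `|a| M); case: (leP `|b| M); lra.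
rewrite /trunc_power !exprS -/(trunc_power M p a) -/(trunc_power M p b).
set x := Num.min `|a| M in min1 *; set y := Num.min `|b| M in min1 *.
have -> : x * trunc_power M p a - y * trunc_power M p b =
  x * (trunc_power M p a - trunc_power M p b) + (x - y) * trunc_power M p b by ring.
rewrite (le_trans (ler_normD _ _))// !normrM mulrDl lerD//.
  by rewrite -mulrA ler_pM// ?normr_ge0 ?mulr_ge0//; exact: minM.
rewrite mulrC ler_pM// ger0_norm ?trunc_power_ge0//.
exact: trunc_power_le.
Qed.

End truncated_power.

Section limit.
Local Open Scope ereal_scope.
Context d (T : measurableType d) (R : realType) (P : probability T R).

(** Replacing A by Q_N costs at most eps E[p^2] + (L^2 / eps) E[(A - Q_N)^2], and likewise for the
    return with weight q: eps is fixed first, then N is taken large. Exchanging p and q gives the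
    reverse inequality. *)
Lemma lipschitz_limit_le (p q A : T -> R) (Q : nat -> T -> R) (f : R -> R)
    (L C B : R) :
  (forall w, (0 <= p w)%R) -> (forall w, (0 <= q w)%R) ->
  sq_integrable P p -> sq_integrable P q ->
  measurable_fun setT A -> (forall N, (0 < N)%N -> measurable_fun setT (Q N)) ->
  measurable_fun setT f -> (forall a, (0 <= f a)%R) ->
  (0 <= L)%R -> (forall a b, `|f a - f b| <= L * `|a - b|)%R ->
  (forall N, (0 < N)%N ->
    sq_norm P (fun w => A w - Q N w)%R <= (C / N%:R)%:E) ->
  (forall N, (0 < N)%N ->
    \int[P]_w (p w * f (Q N w))%:E = \int[P]_w (q w * f (Q N w))%:E) ->
  \int[P]_w (p w * f (A w))%:E <= \int[P]_w (q w * f (A w))%:E.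
Proof.
move=> p0 q0 [mp poo] [mq qoo] mA mQ mf f0 L0 fL dist eqPQ.
have key (eps : R) (r A1 A2 : T -> R) : (0 < eps)%R -> (forall w, (0 <= r w)%R) ->
    measurable_fun setT r -> measurable_fun setT A1 -> measurable_fun setT A2 ->
    \int[P]_w (r w * f (A1 w))%:E <= \int[P]_w (r w * f (A2 w))%:E +
      (eps%:E * \int[P]_w (r w ^+ 2)%:E +
       (L ^+ 2 / eps)%:E * sq_norm P (fun w => A1 w - A2 w)%R).
  move=> eps0 r0 mr m1 m2.
  have mrf B' : measurable_fun setT B' ->
      measurable_fun setT (fun w => (r w * f (B' w))%:E).
    move=> mB; apply/measurable_EFinP; apply: measurable_funM => //.
    exact: measurableT_comp.
  have mrf1 := mrf _ m1; have mrf2 := mrf _ m2.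
  have mr2 := measurable_sqr mr; have m12 := measurable_sqr (measurable_funB m1 m2).
  have r2 w : 0 <= (r w ^+ 2)%:E by rewrite lee_fin sqr_ge0.
  have s12 w : 0 <= ((A1 w - A2 w) ^+ 2)%:E by rewrite lee_fin sqr_ge0.
  have rf B' w : 0 <= (r w * f (B' w))%:E by rewrite lee_fin mulr_ge0.
  have Le : (0 <= L ^+ 2 / eps)%R by rewrite divr_ge0 ?sqr_ge0// ltW.
  rewrite /sq_norm -!ge0_integralZl//; try by rewrite lee_fin// ltW.
  have me2 : measurable_fun setT (fun w => eps%:E * (r w ^+ 2)%:E).
    exact: measurable_funeM.
  have ml2 : measurable_fun setT (fun w => (L ^+ 2 / eps)%:E * ((A1 w - A2 w) ^+ 2)%:E).
    exact: measurable_funeM.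
  have e2 w : 0 <= eps%:E * (r w ^+ 2)%:E by rewrite mule_ge0// lee_fin ltW.
  have l2 w : 0 <= (L ^+ 2 / eps)%:E * ((A1 w - A2 w) ^+ 2)%:E by rewrite mule_ge0.
  rewrite -ge0_integralD// -ge0_integralD//; last 2 first.
  - by move=> w _; rewrite adde_ge0.
  - exact: emeasurable_funD.
  apply: ge0_le_integral => //.
    by apply: emeasurable_funD => //; exact: emeasurable_funD.
  move=> w _; rewrite -!EFinM -!EFinD lee_fin.
  have fAB : (f (A1 w) <= f (A2 w) + L * `|A1 w - A2 w|)%R.
    by have := fL (A1 w) (A2 w); rewrite ler_norml => /andP[_]; lra.
  apply: (le_trans (ler_wpM2l (r0 w) fAB)); rewrite mulrDr lerD2l.
  rewrite -(real_normK (num_real (A1 w - A2 w))).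
  set D := `|_|%R; rewrite -(ler_pM2l eps0).
  have -> : (eps * (eps * r w ^+ 2 + L ^+ 2 / eps * D ^+ 2) =
    (eps * r w) ^+ 2 + (L * D) ^+ 2)%R by field; rewrite gt_eqF.
  (* Multiplied by eps, the claim is x y <= x^2 + y^2 with x = eps r and y = L D, both
     nonnegative. *)
  have := sqr_ge0 (eps * r w - L * D)%R.
  have D0 : (0 <= D)%R by exact: normr_ge0.
  have : (0 <= (eps * r w) * (L * D))%R.
    by apply: mulr_ge0; apply: mulr_ge0 => //; exact: ltW.
  nra.
have fin_sq (r : T -> R) : \int[P]_w (r w ^+ 2)%:E < +oo ->
    exists2 v, (0 <= v)%R & \int[P]_w (r w ^+ 2)%:E = v%:E.
  move=> roo; exists (fine (\int[P]_w (r w ^+ 2)%:E)).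
    by apply: fine_ge0; apply: integral_ge0 => w _; rewrite lee_fin sqr_ge0.
  rewrite fineK// ge0_fin_numE//.
  by apply: integral_ge0 => w _; rewrite lee_fin sqr_ge0.
have [u u0 pu] := fin_sq _ poo; have [v v0 qv] := fin_sq _ qoo.
apply/lee_addgt0Pr => e e0.
(* The two weight terms add up to eps (u + v) <= e / 2, and the two distance terms to K / N <= e /
   2; the summand 1 keeps the denominator positive. *)
pose eps := (e / (2 * (u + v + 1)))%R.
have uv1 : (0 < 2 * (u + v + 1))%R by lra.
have eps0 : (0 < eps)%R by rewrite divr_gt0.
pose K := (2 * (L ^+ 2 / eps * C))%R.
pose N := (Num.truncn (2 * K / e)).+1.
have N0 : (0 < N)%N by [].
have KN : (K / N%:R <= e / 2)%R.
  have := truncnS_gt (2 * K / e)%R; rewrite -/N => KN.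
  rewrite ler_pdivrMr ?ltr0n//.
  move: KN; rewrite ltr_pdivrMr// => /ltW; lra.
have H1 := key eps p A (Q N) eps0 p0 mp mA (mQ N N0).
have H2 := key eps q (Q N) A eps0 q0 mq (mQ N N0) mA.
rewrite sq_normC in H2.
have Le : 0 <= (L ^+ 2 / eps)%:E by rewrite lee_fin divr_ge0 ?sqr_ge0// ltW.
have HD := lee_wpmul2l Le (dist N N0).
apply: (le_trans H1); rewrite eqPQ//.
apply: (le_trans (leeD2r _ H2)).
rewrite -addeA leeD2l// pu qv.
apply: (le_trans (leeD (leeD2l _ HD) (leeD2l _ HD))).
rewrite -!EFinM -!EFinD lee_fin.
have euv : (eps * u + eps * v <= e / 2)%R.
  rewrite -mulrDr /eps -mulrA ler_wpM2l ?(ltW e0)// invfM -mulrA.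
  rewrite ler_piMr// mulrC ler_pdivrMr; lra.
have -> : (eps * v + L ^+ 2 / eps * (C / N%:R) +
   (eps * u + L ^+ 2 / eps * (C / N%:R)) =
   (eps * u + eps * v) + K / N%:R)%R by rewrite /K; ring.
lra.
Qed.

End limit.

Section coefficients.
Context {R : realType}.

(** On the circle c and s are not independent, so coefficients cannot be compared directly. Setting
    s = c x and dividing by c^(2m) = (1 + x^2)^(- m) yields an identity in the free variable x,
    namely sum_j C(2m, j) M_j x^j = M_0 (1 + x^2)^m. Points with c > 0 reach every x. *)
Lemma homogeneous_coef (m l : nat) (M : nat -> R) : (l <= m)%N ->
  (forall c s : R, c ^+ 2 + s ^+ 2 = 1 -> 0 < c ->
    \sum_(j < (2 * m).+1) c ^+ (2 * m - j) * s ^+ j *+ 'C(2 * m, j) * M j = M 0%N) ->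
  'C(2 * m, 2 * l)%:R * M (2 * l)%N = 'C(m, l)%:R * M 0%N.
Proof.
move=> lm H.
pose p : {poly R} := \poly_(j < (2 * m).+1) (M j *+ 'C(2 * m, j)).
pose q : {poly R} := M 0%N *: ((1 + 'X) ^+ m \Po 'X^2).
have pq x : p.[x] = q.[x].
  rewrite horner_poly hornerZ horner_comp !hornerE.
  set r := 1 + x ^+ 2; have r0 : 0 < r by rewrite ltr_pwDl// sqr_ge0.
  pose c := (Num.sqrt r)^-1; have c0 : 0 < c by rewrite invr_gt0 sqrtr_gt0.
  have c2 : c ^+ 2 * r = 1.
    by rewrite exprVn sqr_sqrtr ?ltW// mulVf// gt_eqF.
  have cs : c ^+ 2 + (c * x) ^+ 2 = 1.
    by rewrite -c2 exprMn /r mulrDr mulr1.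
  have cm : c ^+ (2 * m) * r ^+ m = 1 by rewrite exprM -exprMn c2 expr1n.
  rewrite -(H _ _ cs c0) mulr_suml; apply: eq_bigr => j _.
  have jm : (j <= 2 * m)%N by rewrite -ltnS.
  rewrite exprMn mulrA -exprD subnK// -[LHS]mul1r -cm.
  by rewrite -(mulr_natr (M j)) -(mulr_natr (c ^+ _ * _)); ring.
have {pq} pq : p = q.
  apply/eqP; rewrite -subr_eq0; apply/negPn/negP => pq0.
  (* A nonzero polynomial has fewer roots than its size, while p - q vanishes at each of these
     integers. *)
  pose rs : seq R := [seq i%:R | i <- iota 0 (size (p - q))].
  have := max_poly_roots pq0 (_ : all (root (p - q)) rs).
  rewrite size_map size_iota ltnn => abs.
  suff : false by []; apply: abs.
    by apply/allP => x _; rewrite /root hornerD hornerN pq subrr.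
  by rewrite map_inj_uniq ?iota_uniq//; exact: mulrIn (oner_neq0 _).
have := congr1 (fun P : {poly R} => P`_(2 * l)) pq.
rewrite /p /q coef_poly ltnS leq_mul2l lm orbT coefZ.
rewrite coef_comp_poly_Xn// dvdn_mulr// mulKn//.
move=> E; rewrite mulr_natl {}E [RHS]mulrC; congr (_ * _).
rewrite exprDn coef_sum (bigD1 (Ordinal (lm : (l < m.+1)%N)))//= big1 ?addr0.
  by rewrite expr1n mul1r coefMn coefXn eqxx.
move=> i /eqP il; rewrite expr1n mul1r coefMn coefXn.
by case: eqP => // li; [case: il; exact: val_inj|rewrite mul0rn].
Qed.

End coefficients.

Section moments.
Local Open Scope ereal_scope.
Context d (T : measurableType d) (R : realType) (P : probability T R).
Variables W1 W2 : R -> {RV P >-> R}.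
Hypotheses (w1 : standard_wiener W1) (w2 : standard_wiener W2).
Hypothesis indep : independent_processes W1 W2.
Variables (t : R) (A : {RV P >-> R}).
Hypotheses (t_ge0 : (0 <= t)%R) (areaA : is_area_integral W1 W2 t (t + 1) A).

Notation X := (incr W1 t (t + 1)).
Notation Y := (incr W2 t (t + 1)).

Let mX : measurable_fun setT X. Proof. exact: measurable_incr. Qed.
Let mY : measurable_fun setT Y. Proof. exact: measurable_incr. Qed.

Lemma incr_moment_lty (F : R -> set (set T)) (W : R -> {RV P >-> R}) n :
  brownian_wrt F W -> \int[P]_w (incr W t (t + 1) w ^+ (2 * n))%:E < +oo.
Proof.
move=> bW; have t1 : (t < t + 1)%R by rewrite ltrDl.
have sig : (0 < Num.sqrt (t + 1 - t) :> R)%R by rewrite sqrtr_gt0 subr_gt0.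
(* With a constant as first component, the independence formula reduces to integration against the
   law of the increment. *)
have := @ge0_integral_indep _ _ _ P _ _ R (measurableTypeR R) _ _ _
  (normal_prob 0 (Num.sqrt (t + 1 - t))) (brownian_measurable bW (s := t))
  (@measurable_wrt_cst _ _ _ (F t) 0%R) (measurable_incr W t (t + 1))
  (brownian_indep bW t_ge0 t1) (fun p => (p.2 ^+ (2 * n))%:E).
have mf : measurable_fun [set: R * measurableTypeR R] (fun p => (p.2 ^+ (2 * n))%:E).
  by apply/measurable_EFinP; apply: measurable_funX; exact: measurable_snd.
have f0 (p : R * measurableTypeR R) : 0 <= (p.2 ^+ (2 * n))%:E.
  by rewrite lee_fin exprM exprn_ge0// sqr_ge0.
move=> /(_ mf f0) /= ->.
rewrite integral_cst//= [X in _ * X](_ : _ = 1); last exact: probability_setT.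
by rewrite mule1; apply: normal_prob_moment_lty; exact: lt0r_neq0.
Qed.

Lemma sq_integrable_powX i : sq_integrable P (fun w => X w ^+ i)%R.
Proof.
split; first exact: measurable_funX.
under eq_integral do rewrite -exprM mulnC.
apply: incr_moment_lty (brownian_joint w1 (independent_processesC indep)).
Qed.

Lemma sq_integrable_powY i : sq_integrable P (fun w => Y w ^+ i)%R.
Proof.
split; first exact: measurable_funX.
under eq_integral do rewrite -exprM mulnC.
apply: incr_moment_lty (brownian_joint w2 indep).
Qed.

Section truncated.
Variables (f : R -> R) (L B : R).
Hypotheses (mf : measurable_fun setT f) (f0 : forall a, (0 <= f a)%R).
Hypotheses (fB : forall a, (f a <= B)%R) (L0 : (0 <= L)%R).
Hypothesis fL : forall a b, (`|f a - f b| <= L * `|a - b|)%R.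

Lemma integral_rotated_moment (c s : R) (m : nat) :
  (c ^+ 2 + s ^+ 2 = 1)%R -> (0 < 1 + c)%R ->
  \int[P]_w ((c * X w + s * Y w) ^+ (2 * m) * f (A w))%:E =
  \int[P]_w (X w ^+ (2 * m) * f (A w))%:E.
Proof.
move=> cs c1; pose U w := (c * X w + s * Y w)%R.
have mU : measurable_fun setT U by apply: measurable_funD; exact: measurable_funM.
have mz : measurable_fun setT (fun z : (R * R) * R => z.1.1).
  exact: measurableT_comp measurable_fst measurable_fst.
have U2m w : (0 <= U w ^+ (2 * m))%R by rewrite exprM exprn_ge0// sqr_ge0.
have X2m w : (0 <= X w ^+ (2 * m))%R by rewrite exprM exprn_ge0// sqr_ge0.
have sX : sq_integrable P (fun w => X w ^+ (2 * m))%R by exact: sq_integrable_powX.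
have rot N (g : (R * R) * R -> \bar R) : (0 < N)%N -> measurable_fun setT g ->
    (forall z, 0 <= g z) ->
    \int[P]_w g ((U w, (- s * X w + c * Y w)%R), area_sum W1 W2 t N w) =
    \int[P]_w g ((X w, Y w), area_sum W1 W2 t N w).
  move=> N0 mg g0; have := integral_state_rotation w1 w2 indep t_ge0 N0 N cs c1 mg g0.
  by under eq_integral do rewrite stateN//; under [RHS]eq_integral do rewrite stateN//.
(* U has the moments of X by the rotation invariance itself; the area is ignored here, so N = 1 will
   do. *)
have sU : sq_integrable P (fun w => U w ^+ (2 * m))%R.
  split; first exact: measurable_funX.
  have [_] := sX; apply: le_lt_trans; rewrite le_eqVlt; apply/orP; left; apply/eqP.
  apply: (rot 1%N (fun z => ((z.1.1 ^+ (2 * m)) ^+ 2)%:E)) => //.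
    by apply/measurable_EFinP; do 2 apply: measurable_funX.
  by move=> z; rewrite lee_fin sqr_ge0.
have eqN N : (0 < N)%N ->
    \int[P]_w (U w ^+ (2 * m) * f (area_sum W1 W2 t N w))%:E =
    \int[P]_w (X w ^+ (2 * m) * f (area_sum W1 W2 t N w))%:E.
  move=> N0; apply: (rot N (fun z => (z.1.1 ^+ (2 * m) * f z.2)%:E)) => //.
    apply/measurable_EFinP; apply: measurable_funM; first exact: measurable_funX.
    exact: measurableT_comp.
  by move=> z; rewrite lee_fin mulr_ge0// exprM exprn_ge0// sqr_ge0.
have mQ N : (0 < N)%N -> measurable_fun setT (area_sum W1 W2 t N).
  by move=> N0; exact: measurable_area_sum.
have dist N (N0 : (0 < N)%N) := area_sum_dist w1 w2 indep N0 t_ge0 areaA.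
have mA : measurable_fun setT A by [].
apply/eqP; rewrite eq_le; apply/andP; split.
  by apply: (@lipschitz_limit_le _ _ _ P _ _ A (area_sum W1 W2 t) f L
    (32 * std_variance ^+ 2)%R).
apply: (@lipschitz_limit_le _ _ _ P _ _ A (area_sum W1 W2 t) f L
    (32 * std_variance ^+ 2)%R) => //.
by move=> N N0; rewrite eqN.
Qed.

Let M i j := fine (\int[P]_w (X w ^+ i * Y w ^+ j * f (A w))%:E).

(** Since f is bounded, the Gaussian moments dominate, and the binomial expansion of (c X + s
    Y)^(2m) can be integrated term by term. *)
Let MP i j : has_integral P (fun w => X w ^+ i * Y w ^+ j * f (A w))%R (M i j).
Proof.
apply: has_integral_fine.
have iXY := sq_integrableM (sq_integrable_powX i) (sq_integrable_powY j).
apply: (le_integrable _ _ _ (integrableZl measurableT B iXY)) => //.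
  apply/measurable_EFinP; apply: measurable_funM; last exact: measurableT_comp.
  by apply: measurable_funM; exact: measurable_funX.
move=> w _; rewrite -EFinM !abse_EFin lee_fin [X in (X <= _)%R]normrM
  [X in (_ <= X)%R]normrM mulrC.
by rewrite ler_wpM2r// !ger0_norm// (le_trans (f0 (A w))).
Qed.

Lemma truncated_moment (m l : nat) : (l <= m)%N ->
  \int[P]_w (X w ^+ (2 * (m - l)) * Y w ^+ (2 * l) * f (A w))%:E =
  ('C(m, l)%:R / 'C(2 * m, 2 * l)%:R)%:E * \int[P]_w (X w ^+ (2 * m) * f (A w))%:E.
Proof.
move=> lm.
have M0 : \int[P]_w (X w ^+ (2 * m) * f (A w))%:E = (M (2 * m) 0)%:E.
  have [_ <-] := MP (2 * m) 0.
  by apply: eq_integral => w _; rewrite expr0 mulr1.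
have := @homogeneous_coef R m l (fun j => M (2 * m - j) j) lm.
rewrite subn0 => E; rewrite -mulnBr in E.
have {}E : ('C(2 * m, 2 * l)%:R * M (2 * (m - l)) (2 * l) =
    'C(m, l)%:R * M (2 * m) 0)%R.
  apply: E => c s cs c0.
  have c1 : (0 < 1 + c)%R by rewrite addr_gt0.
  have H : has_integral P (fun w => (c * X w + s * Y w) ^+ (2 * m) * f (A w))%R
      (\sum_(j < (2 * m).+1) c ^+ (2 * m - j) * s ^+ j *+ 'C(2 * m, j) *
         M (2 * m - j) j)%R.
    pose G j w := (c ^+ (2 * m - j) * s ^+ j *+ 'C(2 * m, j) *
      (X w ^+ (2 * m - j) * Y w ^+ j * f (A w)))%R.
    apply: (@has_integral_eq _ _ _ _ (fun w => \sum_(j < (2 * m).+1) G j w)%R).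
      move=> w; rewrite exprDn mulr_suml; apply: eq_bigr => j _.
      by rewrite /G !exprMn !mulrnAl; congr (_ *+ _)%R; ring.
    apply: (@has_integral_sum _ _ _ _ _ G
      (fun j => c ^+ (2 * m - j) * s ^+ j *+ 'C(2 * m, j) * M (2 * m - j) j)%R).
    by move=> j _; exact: has_integralZ.
  have [_] := H; rewrite integral_rotated_moment// M0 => -[].
  by move=> ->.
have [_ ->] := MP (2 * (m - l)) (2 * l).
rewrite M0 -EFinM; congr EFin.
have C0 : ('C(2 * m, 2 * l)%:R != 0 :> R)%R.
  by rewrite pnatr_eq0 -lt0n bin_gt0 leq_mul2l.
by apply: (mulfI C0); rewrite E mulrA mulrCA divff// mulr1.
Qed.

End truncated.

Lemma area_moment (m k l : nat) : (l <= m)%N ->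
  \int[P]_w (X w ^+ (2 * (m - l)) * A w ^+ (2 * k) * Y w ^+ (2 * l))%:E =
  ('C(m, l)%:R / 'C(2 * m, 2 * l)%:R)%:E *
  \int[P]_w (X w ^+ (2 * m) * A w ^+ (2 * k))%:E.
Proof.
move=> lm.
have even_ge0 (x : R) n : (0 <= x ^+ (2 * n))%R by rewrite exprM exprn_ge0// sqr_ge0.
have mA : measurable_fun setT A by [].
have trunc_cvg (Z : T -> R) : measurable_fun setT Z -> (forall w, (0 <= Z w)%R) ->
    \int[P]_w (Z w * trunc_power n%:R (2 * k) (A w))%:E @[n --> \oo] -->
    \int[P]_w (Z w * A w ^+ (2 * k))%:E.
  move=> mZ Z0; pose g n w := (Z w * trunc_power n%:R (2 * k) (A w))%:E.
  have -> : \int[P]_w (Z w * A w ^+ (2 * k))%:E = \int[P]_w limn (g^~ w).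
    apply: eq_integral => w _; apply/esym/cvg_lim => //.
    (* For fixed w the truncation is exact once n >= |A w|, so the sequence is eventually
       constant. *)
    apply: cvg_near_cst; near=> n; rewrite /g trunc_power_id//; near: n.
    exists (Num.truncn `|A w|).+1 => //= n An.
    by rewrite (le_trans (ltW (truncnS_gt _)))// ler_nat.
  apply: (@cvg_monotone_convergence _ _ _ P setT measurableT g).
  - move=> n; apply/measurable_EFinP; apply: measurable_funM => //.
    by apply: (measurableT_comp _ mA); exact: measurable_trunc_power.
  - by move=> n w _; rewrite lee_fin mulr_ge0// trunc_power_ge0.
  - move=> w _ n n' nn'; rewrite lee_fin ler_wpM2l//.
    by rewrite trunc_power_nd// ler_nat.
set r := (_ / _)%R.
have H1 : \int[P]_w (X w ^+ (2 * (m - l)) * Y w ^+ (2 * l) *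
      trunc_power n%:R (2 * k) (A w))%:E @[n --> \oo] -->
    \int[P]_w (X w ^+ (2 * (m - l)) * Y w ^+ (2 * l) * A w ^+ (2 * k))%:E.
  apply: (trunc_cvg (fun w => X w ^+ (2 * (m - l)) * Y w ^+ (2 * l))%R).
    by apply: measurable_funM; exact: measurable_funX.
  by move=> w; rewrite mulr_ge0.
have H2 : r%:E * \int[P]_w (X w ^+ (2 * m) *
      trunc_power n%:R (2 * k) (A w))%:E @[n --> \oo] -->
    r%:E * \int[P]_w (X w ^+ (2 * m) * A w ^+ (2 * k))%:E.
  apply: cvgeZl => //; apply: (trunc_cvg (fun w => X w ^+ (2 * m))%R) => //.
  exact: measurable_funX.
have E n : \int[P]_w (X w ^+ (2 * (m - l)) * Y w ^+ (2 * l) *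
      trunc_power n%:R (2 * k) (A w))%:E =
    r%:E * \int[P]_w (X w ^+ (2 * m) * trunc_power n%:R (2 * k) (A w))%:E.
  have n0 : (0 <= n%:R :> R)%R by exact: ler0n.
  have [L L0 fL] := trunc_power_lipschitz (2 * k) n0.
  apply: (@truncated_moment (trunc_power n%:R (2 * k)) L (n%:R ^+ (2 * k))%R) => //.
  - exact: measurable_trunc_power.
  - by move=> a; exact: trunc_power_ge0.
  - by move=> a; exact: trunc_power_le.
under eq_integral do rewrite mulrAC.
rewrite (funext E) in H1; exact: cvg_unique H1 H2.
Unshelve. all: by end_near.
Qed.

End moments.

Local Close Scope classical_set_scope.

Theorem mainTheorem3 (R : realType) (d : measure_display) (T : measurableType d)
    (P : probability T R) (W1 W2 : R -> {RV P >-> R})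
    (wienerW1 : standard_wiener W1) (wienerW2 : standard_wiener W2)
    (indepW : independent_processes W1 W2)
    (t : R) (t_ge0 : 0 <= t)
    (A : {RV P >-> R}) (areaA : is_area_integral W1 W2 t (t + 1) A)
    (k l n : nat) (le_n : (2 * k + l <= n)%N) :
  gamma W1 W2 t A (n - 2 * k - l) k l =
  (('C(n - 2 * k, l)%:R / 'C(2 * (n - 2 * k), 2 * l)%:R : R)%:E *
   gamma W1 W2 t A (n - 2 * k) k 0)%E.
Proof.
rewrite /gamma unlock -subnDA; have lm : (l <= n - 2 * k)%N.
  by rewrite leq_subRL ?(leq_trans (leq_addr l _) le_n).
rewrite subnDA (area_moment wienerW1 wienerW2 indepW t_ge0 areaA k lm).
congr (_ * _)%E; apply: eq_integral => w _.
by rewrite muln0 expr0 mulr1.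
Qed.
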